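(* Let $g(t)=\sum_{k=1}^N\frac{a_k}{t-iw_k}$ with $a_k,w_k\in\mathbb{C}$, $a_k\neq0$, $\Re w_k\neq0$, and let $\alpha\in(0,1]$. For $k=1,\dots,N$ and $s=0,\dots,N-1$ set $$A_{k,s}=(-1)^s\sum_{\substack{j_1<j_2<\dots<j_s\\ j_l\neq k}} e^{\frac{2\pi}{\alpha}(w_{j_1}+\dots+w_{j_s})}$$ (the sum over $s$-element subsets of $\{1,\dots,N\}\setminus\{k\}$; $A_{k,0}=1$), and $$m_s(\xi)=\sum_{k=1}^N a_kA_{k,s}e^{2\pi\xi w_k}.$$ Then the following are equivalent: (1) $\mathcal{G}(g;\alpha,1)$ is a frame in $L^2(\mathbb{R})$; (2) there exist constants $0<c\le C<\infty$ such that for all $G\in L^2(\mathbb{R})$ $$c\|G\|^2_{L^2(\mathbb{R})}\le\int_0^{1/\alpha}\sum_{n\in\mathbb{Z}}\Big|\sum_{s=0}^{N-1}G\Big(\xi+n+\frac{s}{\alpha}\Big)m_s(\xi)\Big|^2d\xi\le C\|G\|^2_{L^2(\mathbb{R})}.$$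
   Context: $\mathcal{G}(g;\alpha,1)=\{e^{2\pi i n t}g(t-\alpha m)\}_{m,n\in\mathbb{Z}}$; it is a frame in $L^2(\mathbb{R})$ if there are $0<A\le B<\infty$ with $A\|f\|^2\le\sum_{m,n}|\langle f, e^{2\pi i n\cdot}g(\cdot-\alpha m)\rangle|^2\le B\|f\|^2$ for all $f\in L^2(\mathbb{R})$. *)

(* Defs.v *)
(* MathComp-Analysis (R : realType, Lebesgue measure) +
   mathcomp-real-closed complex numbers R[i]. *)
From HB Require Import structures.
From mathcomp Require Import all_boot all_order all_algebra.
From mathcomp Require Import all_classical all_reals all_analysis.
From mathcomp Require Import complex.

Set Implicit Arguments.
Unset Strict Implicit.
Unset Printing Implicit Defensive.

Import Order.TTheory GRing.Theory Num.Theory.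
Local Open Scope ring_scope.
Local Open Scope complex_scope.

Section GaborDefs.
Variable R : realType.

Local Notation C := (R[i]).
Local Notation mu := (@lebesgue_measure R).

(* complex exponential  e^{x+iy} = e^x (cos y + i sin y) *)
Definition cexp (z : C) : C :=
  (expR (complex.Re z) * cos (complex.Im z)) +i* (expR (complex.Re z) * sin (complex.Im z)).

(* |z|^2 as a real number *)
Definition normsq (z : C) : R := complex.Re z ^+ 2 + complex.Im z ^+ 2.

(* f : R -> C belongs to L^2(R) (Lebesgue measure) *)
Definition L2 (f : R -> C) : Prop :=
  [/\ measurable_fun setT (fun x => complex.Re (f x)),
      measurable_fun setT (fun x => complex.Im (f x)) &
      (\int[mu]_x ((normsq (f x))%:E) < +oo)%E].

(* ||f||^2_{L^2(R)} (extended real) *)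
Definition L2norm2 (f : R -> C) : \bar R := (\int[mu]_x ((normsq (f x))%:E))%E.

(* <f, h> = int f(x) conj(h(x)) dx *)
Definition inner (f h : R -> C) : C :=
  (Rintegral mu setT (fun x => complex.Re (f x * (h x)^*))) +i*
  (Rintegral mu setT (fun x => complex.Im (f x * (h x)^*))).

(* the Gabor atom  t |-> e^{2 pi i n t} g(t - alpha m) *)
Definition gabor_atom (g : R -> C) (alpha : R) (m n : int) : R -> C :=
  fun t => cexp (0 +i* (2 * pi * n%:~R * t)) * g (t - alpha * m%:~R).

(* G(g; alpha, 1) is a frame in L^2(R) *)
Definition is_gabor_frame (g : R -> C) (alpha : R) : Prop :=
  exists A B : R, [/\ 0 < A, A <= B &
    forall f : R -> C, L2 f ->
      (A%:E * L2norm2 f <=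
         \esum_(mn in [set: int * int]) (normsq (inner f (gabor_atom g alpha mn.1 mn.2)))%:E
       <= B%:E * L2norm2 f)%E].

(* g(t) = sum_k a_k / (t - i w_k) *)
Definition gfun (N : nat) (a w : 'I_N -> C) (t : R) : C :=
  \sum_(k < N) a k / (t%:C - 'i * w k).

(* A_{k,s} = (-1)^s sum over s-subsets J of {1..N}\{k} of e^{(2pi/alpha) sum_{j in J} w_j} *)
Definition Acoef (N : nat) (w : 'I_N -> C) (alpha : R) (k : 'I_N) (s : nat) : C :=
  (-1) ^+ s * \sum_(J : {set 'I_N} | (k \notin J) && (#|J| == s))
                 cexp ((2 * pi / alpha)%:C * \sum_(j in J) w j).

(* m_s(xi) = sum_k a_k A_{k,s} e^{2 pi xi w_k} *)
Definition mfun (N : nat) (a w : 'I_N -> C) (alpha : R) (s : nat) (xi : R) : C :=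
  \sum_(k < N) a k * Acoef w alpha k s * cexp ((2 * pi * xi)%:C * w k).

(* condition (2) of the theorem *)
Definition cond2 (N : nat) (a w : 'I_N -> C) (alpha : R) : Prop :=
  exists c C0 : R, [/\ 0 < c, c <= C0 &
    forall G : R -> C, L2 G ->
      (c%:E * L2norm2 G <=
         (\int[mu]_(xi in `[0%R, (alpha^-1)%R]%classic)
            \esum_(n in [set: int])
               (normsq (\sum_(s < N) G (xi + n%:~R + s%:R / alpha)%R * mfun a w alpha s xi)%R)%:E)
       <= C0%:E * L2norm2 G)%E].

End GaborDefs.

(* Main.v *)
(** Write e(x) = exp(2 pi i x), z_k = exp(2 pi w_k / alpha) and
    p(t) = \prod_k (1 - conj z_k e(- t / alpha)).  Since Re w_k <> 0 we have
    |z_k| <> 1, so p is bounded above and away from zero, and p is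
    alpha-periodic.  The zeros of its factors cancel the poles of conj g, and
      p(t) conj (g(t)) = 2 pi i \sum_s e(- s t / alpha) u_s(t),
    where u_s is the Fourier transform of conj m_s cut off to [0, 1/alpha].
    Hence, for h in L^2 of compact support, the multiplication formula for the
    Fourier transform shows that the inner products of p h with the atoms
    (m, n), for fixed n, are the Fourier coefficients on [0, 1/alpha] of
      2 pi i \sum_s conj m_s(x) (fourier h)(x + n + s / alpha),
    and Parseval gives: (Gabor sum of p h) = (4 pi^2 / alpha) * (integral of (2)
    at G = conj (fourier h)).  Both upper bounds always hold because the m_s are
    bounded on [0, 1/alpha], and the lower bounds correspond to each other since
    |p h| ~ |h| pointwise, the Fourier transform is isometric, and the functions
    p h (resp. conj (fourier h)) are dense in L^2. *)
Require Import Defs.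
From HB Require Import structures.
From mathcomp Require Import all_boot all_order all_algebra.
From mathcomp Require Import all_classical all_reals all_analysis.
From mathcomp Require Import finmap measurable_realfun complex.
From mathcomp Require Import ring lra.

Import Order.TTheory GRing.Theory Num.Theory.
Import numFieldNormedType.Exports.
Local Open Scope classical_set_scope.
Local Open Scope ring_scope.
Local Open Scope complex_scope.
Set Implicit Arguments.
Unset Strict Implicit.
Unset Printing Implicit Defensive.

(** * Complex-valued functions and their integrals *)

Section complex_algebra.
Context {R : realType}.
Implicit Types (z u : R[i]) (x y : R).

(** Why one multiplier and one cut-off serve all atoms: a time shift by alpha m leaves p unchanged
    by periodicity, and leaves each factor e(- s t / alpha) unchanged because e(s m) = 1. The shift
    therefore acts on u_s alone, that is, it multiplies the cut-off function by e(alpha m x). These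
    characters form an orthogonal basis on an interval of length 1 / alpha, which is exactly the
    length of the cut-off. The obstacle is that the Fourier transform is used only as an absolutely
    convergent integral. This is why h has compact support. Neither an extension to L^2 nor an
    inversion theorem is invoked: Plancherel on this class follows from Parseval on one period, and
    density of the transforms follows from the multiplication formula. Norms appear squared
    throughout, so |x + y|^2 <= 2 |x|^2 + 2 |y|^2 replaces the triangle inequality. Two uses of it
    cost the factor 4 in the lower bounds. *)

Lemma complexP z u : complex.Re z = complex.Re u -> complex.Im z = complex.Im u -> z = u.
Proof. by case: z => a b; case: u => c d /= -> ->. Qed.

Lemma cReD z u : complex.Re (z + u) = complex.Re z + complex.Re u.
Proof. by case: z; case: u. Qed.
Lemma cImD z u : complex.Im (z + u) = complex.Im z + complex.Im u.
Proof. by case: z; case: u. Qed.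
Lemma cReN z : complex.Re (- z) = - complex.Re z.
Proof. by case: z. Qed.
Lemma cImN z : complex.Im (- z) = - complex.Im z.
Proof. by case: z. Qed.
Lemma cReM z u : complex.Re (z * u) =
  complex.Re z * complex.Re u - complex.Im z * complex.Im u.
Proof. by case: z; case: u. Qed.
Lemma cImM z u : complex.Im (z * u) =
  complex.Re z * complex.Im u + complex.Im z * complex.Re u.
Proof. by case: z; case: u. Qed.
Lemma cReJ z : complex.Re (conjc z) = complex.Re z.
Proof. by case: z. Qed.
Lemma cImJ z : complex.Im (conjc z) = - complex.Im z.
Proof. by case: z. Qed.
Lemma cRe0 : complex.Re (0 : R[i]) = 0. Proof. by []. Qed.
Lemma cIm0 : complex.Im (0 : R[i]) = 0. Proof. by []. Qed.
Lemma cRe1 : complex.Re (1 : R[i]) = 1. Proof. by []. Qed.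
Lemma cIm1 : complex.Im (1 : R[i]) = 0. Proof. by []. Qed.
Definition ReImE := (cReD, cImD, cReN, cImN, cReM, cImM, cReJ, cImJ, cRe0, cIm0, cRe1, cIm1).

Lemma normsq_ge0 z : 0 <= normsq z.
Proof. by rewrite addr_ge0 ?sqr_ge0. Qed.

Lemma normsq0 : normsq (0 : R[i]) = 0.
Proof. by rewrite /normsq /= expr0n /= addr0. Qed.

Lemma normsq_eq0 z : (normsq z == 0) = (z == 0).
Proof. by rewrite paddr_eq0 ?sqr_ge0// !sqrf_eq0 eq_complex. Qed.

Lemma normsqJ z : normsq (conjc z) = normsq z.
Proof. by rewrite /normsq !ReImE; ring. Qed.

Lemma normsqN z : normsq (- z) = normsq z.
Proof. by rewrite /normsq !ReImE; ring. Qed.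

Lemma normsqM z u : normsq (z * u) = normsq z * normsq u.
Proof. by rewrite /normsq !ReImE; ring. Qed.

Lemma normsqD z u : normsq (z + u) = normsq z + normsq u + 2 * complex.Re (z * (conjc u)).
Proof. by rewrite /normsq !ReImE; ring. Qed.

Lemma normsqD_le z u : normsq (z + u) <= 2 * (normsq z + normsq u).
Proof.
have := normsq_ge0 (z - u); rewrite /normsq !ReImE; nra.
Qed.

Lemma mulJ_normsq z : z * (conjc z) = (normsq z)%:C.
Proof. by apply: complexP; rewrite /normsq !ReImE/=; ring. Qed.

Lemma cJM z u : conjc (z * u) = conjc z * conjc u.
Proof. by apply: complexP; rewrite !ReImE; ring. Qed.

Lemma cJ_sum (I : Type) (r : seq I) (P : pred I) (F : I -> R[i]) :
  conjc (\sum_(i <- r | P i) F i) = \sum_(i <- r | P i) conjc (F i).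
Proof. exact: (rmorph_sum (@conjc R)). Qed.

Lemma normsqC x : normsq x%:C = x ^+ 2.
Proof. by rewrite /normsq /= expr0n addr0. Qed.

(** The constant comes from iterating [normsqD_le]. It is not sharp, but the upper bounds that rely
    on it only need it to be finite. *)
Lemma normsq_sum_le n (F : 'I_n -> R[i]) :
  normsq (\sum_(i < n) F i) <= 2 ^+ n * \sum_(i < n) normsq (F i).
Proof.
elim: n F => [|n IHn] F; first by rewrite !big_ord0 normsq0 mulr0.
rewrite !big_ord_recl (le_trans (normsqD_le _ _))// exprS -mulrA.
rewrite ler_pM2l// mulrDr lerD// ler_peMl ?normsq_ge0// exprn_ege1//.
by rewrite ler1n.
Qed.

(** Expands |z + u|^2 >= 0 and |z - u|^2 >= 0. It makes a product of two square-integrable functions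
    integrable without Cauchy-Schwarz. *)
Lemma Re_le_normsq z u : `|complex.Re (z * (conjc u))| <= normsq z + normsq u.
Proof.
rewrite ler_norml.
have := normsq_ge0 (z - u); have := normsq_ge0 (z + u); have := normsq_ge0 z;
have := normsq_ge0 u; rewrite /normsq !ReImE => *; apply/andP; split; nra.
Qed.

Lemma Im_le_normsq z u : `|complex.Im (z * (conjc u))| <= normsq z + normsq u.
Proof.
have -> : complex.Im (z * (conjc u)) = complex.Re (z * (conjc ('i%C * u))).
  by rewrite !ReImE/=; ring.
by rewrite (le_trans (Re_le_normsq _ _))// normsqM /normsq/= expr0n add0r expr1n mul1r.
Qed.

Lemma cexpD z u : cexp (z + u) = cexp z * cexp u.
Proof. by apply: complexP; rewrite !ReImE/= !ReImE expRD ?cosD ?sinD; ring. Qed.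

Lemma cexp0 : cexp (0 : R[i]) = 1.
Proof. by rewrite /cexp /= expR0 cos0 sin0 !mul1r. Qed.

Lemma cexpJ z : (conjc (cexp z)) = cexp (conjc z).
Proof. by apply: complexP; rewrite !ReImE/= !ReImE ?cosN ?sinN; ring. Qed.

Lemma cexp_sum (I : Type) (r : seq I) (P : pred I) (F : I -> R[i]) :
  cexp (\sum_(i <- r | P i) F i) = \prod_(i <- r | P i) cexp (F i).
Proof. by apply: (big_morph (@cexp R)); [exact: cexpD|exact: cexp0]. Qed.

Lemma normsq_cexp z : normsq (cexp z) = expR (complex.Re z) ^+ 2.
Proof. by rewrite /normsq /= !exprMn -mulrDr cos2Dsin2 mulr1. Qed.

Definition ee x : R[i] := cexp (0 +i* (2 * pi * x)).

Lemma eeD x y : ee (x + y) = ee x * ee y.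
Proof. by rewrite /ee -cexpD; congr cexp; apply: complexP; rewrite /= ?addr0// mulrDr. Qed.

Lemma ee0 : ee 0 = 1.
Proof. by rewrite /ee mulr0 cexp0. Qed.

Lemma eeJ x : (conjc (ee x)) = ee (- x).
Proof. by rewrite /ee cexpJ; congr cexp; rewrite /= mulrN. Qed.

Lemma normsq_ee x : normsq (ee x) = 1.
Proof. by rewrite normsq_cexp/= expR0 expr1n. Qed.

Lemma ee_nat (n : nat) : ee n%:R = 1.
Proof.
elim: n => [|n IH]; first by rewrite ee0.
rewrite -natr1 eeD IH mul1r /ee mulr1 /cexp/= expR0 !mul1r.
by rewrite mulr_natl cos2pi sin2pi.
Qed.

Lemma ee_int (n : int) : ee n%:~R = 1.
Proof.
case: n => n; first exact: ee_nat.
by rewrite NegzE mulrNz -eeJ ee_nat conjc1.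
Qed.

Lemma ReEe x : complex.Re (ee x) = cos (2 * pi * x).
Proof. by rewrite /= expR0 mul1r. Qed.
Lemma ImEe x : complex.Im (ee x) = sin (2 * pi * x).
Proof. by rewrite /= expR0 mul1r. Qed.

End complex_algebra.

Section complex_integral.
Context d {T : measurableType d} {R : realType}.
Variable mu : {measure set T -> \bar R}.
Implicit Types (D : set T) (f g : T -> R[i]).

Definition cmeas D f := measurable_fun D (fun x => complex.Re (f x)) /\
  measurable_fun D (fun x => complex.Im (f x)).

Lemma cmeasS D D' f : measurable D' -> D `<=` D' -> cmeas D' f -> cmeas D f.
Proof. by move=> mD' sD [? ?]; split; exact: measurable_funS sD _. Qed.

Lemma eq_cmeas D f g : (forall x, D x -> f x = g x) -> cmeas D f -> cmeas D g.
Proof.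
move=> fg [mR mI]; split; [apply: eq_measurable_fun mR|apply: eq_measurable_fun mI];
by move=> x /set_mem Dx; rewrite fg.
Qed.

Lemma cmeas_cst D c : cmeas D (fun=> c).
Proof. by split; exact: measurable_cst. Qed.

Lemma cmeasD D f g : cmeas D f -> cmeas D g -> cmeas D (fun x => f x + g x).
Proof.
by move=> [fR fI] [gR gI]; split; under eq_fun do rewrite !ReImE;
  exact: measurable_funD.
Qed.

Lemma cmeasN D f : cmeas D f -> cmeas D (fun x => - f x).
Proof.
by move=> [fR fI]; split; under eq_fun do rewrite !ReImE; exact: measurableT_comp.
Qed.

Lemma cmeasB D f g : cmeas D f -> cmeas D g -> cmeas D (fun x => f x - g x).
Proof. by move=> mf mg; apply: cmeasD => //; exact: cmeasN. Qed.

Lemma cmeasJ D f : cmeas D f -> cmeas D (fun x => (conjc (f x))).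
Proof.
move=> [fR fI]; split; under eq_fun do rewrite !ReImE; first by [].
exact: measurableT_comp.
Qed.

Lemma cmeasM D f g : cmeas D f -> cmeas D g -> cmeas D (fun x => f x * g x).
Proof.
by move=> [fR fI] [gR gI]; split; under eq_fun do rewrite !ReImE;
  [apply: measurable_funB|apply: measurable_funD]; exact: measurable_funM.
Qed.

Lemma cmeas_sum (I : Type) (r : seq I) (P : pred I) D (F : I -> T -> R[i]) :
  (forall i, P i -> cmeas D (F i)) -> cmeas D (fun x => \sum_(i <- r | P i) F i x).
Proof.
move=> mF; elim: r => [|i r IH].
  by apply: (eq_cmeas (f := fun=> 0)); [move=> x; rewrite big_nil|exact: cmeas_cst].
case Pi : (P i).
  apply: (eq_cmeas (f := fun x => F i x + \sum_(i <- r | P i) F i x)).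
    by move=> x; rewrite big_cons Pi.
  by apply: cmeasD => //; exact: mF.
by apply: eq_cmeas IH => x; rewrite big_cons Pi.
Qed.

Lemma measurable_normsq D f : cmeas D f -> measurable_fun D (fun x => normsq (f x)).
Proof. by move=> [fR fI]; apply: measurable_funD; exact: measurable_funX. Qed.

Lemma measurable_normsqE D f : cmeas D f ->
  measurable_fun D (fun x => (normsq (f x))%:E).
Proof. by move=> mf; apply/measurable_EFinP; exact: measurable_normsq. Qed.

(** Componentwise like [inner], so that [inner f h] converts to [cint] of f times the conjugate of
    h. Later proofs switch between the two by conversion. *)
Definition cint D f : R[i] :=
  (Rintegral mu D (fun x => complex.Re (f x))) +i*
  (Rintegral mu D (fun x => complex.Im (f x))).

Definition cintegrable D f :=
  mu.-integrable D (fun x => (complex.Re (f x))%:E) /\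
  mu.-integrable D (fun x => (complex.Im (f x))%:E).

Definition L2on D f := cmeas D f /\ mu.-integrable D (fun x => (normsq (f x))%:E).

(** The squared L^2 norm as a real number. An infinite integral is sent to 0, so the value is
    informative only together with [L2on]. *)
Definition nrm D f := Rintegral mu D (fun x => normsq (f x)).

Lemma Re_cint D f : complex.Re (cint D f) = Rintegral mu D (fun x => complex.Re (f x)).
Proof. by []. Qed.

Lemma Im_cint D f : complex.Im (cint D f) = Rintegral mu D (fun x => complex.Im (f x)).
Proof. by []. Qed.

Lemma eq_cint D f g : (forall x, D x -> f x = g x) -> cint D f = cint D g.
Proof.
by move=> fg; rewrite /cint; congr Complex; apply: eq_Rintegral => x /set_mem Dx;
  rewrite fg.
Qed.

Lemma eq_cintegrable D f g : measurable D -> (forall x, D x -> f x = g x) ->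
  cintegrable D f -> cintegrable D g.
Proof.
by move=> mD fg [iR iI]; split; [apply: eq_integrable iR|apply: eq_integrable iI] => //
  x /set_mem Dx; rewrite fg.
Qed.

Lemma eq_nrm D f g : (forall x, D x -> normsq (f x) = normsq (g x)) ->
  nrm D f = nrm D g.
Proof. by move=> fg; apply: eq_Rintegral => x /set_mem Dx; rewrite fg. Qed.

Lemma eq_L2on D f g : measurable D -> (forall x, D x -> f x = g x) -> L2on D f -> L2on D g.
Proof.
move=> mD fg [mf i]; split; first exact: eq_cmeas mf.
by apply: eq_integrable i => // x /set_mem Dx; rewrite fg.
Qed.

Section fixed_domain.
Variable D : set T.
Hypothesis mD : measurable D.

Lemma integrable_cst (k : R) : (mu D < +oo)%E -> mu.-integrable D (EFin \o (fun=> k)).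
Proof.
move=> fD; apply/integrableP; split; first exact: measurable_cst.
by rewrite (integral_cst mu mD `|k|%:E) lte_mul_pinfty// lee_fin.
Qed.

Lemma cintegrable_meas f : cintegrable D f -> cmeas D f.
Proof. by move=> [/measurable_int/measurable_EFinP ? /measurable_int/measurable_EFinP]. Qed.

Lemma cintegrable_le f (h : T -> R) : cmeas D f -> mu.-integrable D (EFin \o h) ->
  (forall x, D x -> `|complex.Re (f x)| <= h x) ->
  (forall x, D x -> `|complex.Im (f x)| <= h x) -> cintegrable D f.
Proof.
move=> [mR mI] ih hR hI; split; (apply: le_integrable ih => //;
  first exact/measurable_EFinP) => x Dx; rewrite lee_fin.
- by rewrite (le_trans (hR _ Dx))// ler_norm.
- by rewrite (le_trans (hI _ Dx))// ler_norm.
Qed.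

Lemma cintegrableD f g : cintegrable D f -> cintegrable D g ->
  cintegrable D (fun x => f x + g x).
Proof.
by move=> [? ?] [? ?]; split; under eq_fun do rewrite !ReImE EFinD; exact: integrableD.
Qed.

Lemma cintD f g : cintegrable D f -> cintegrable D g ->
  cint D (fun x => f x + g x) = cint D f + cint D g.
Proof.
move=> [? ?] [? ?]; apply: complexP; rewrite !ReImE/= -RintegralD//;
by apply: eq_Rintegral => x _; rewrite !ReImE.
Qed.

Lemma cintegrableZ c f : cintegrable D f -> cintegrable D (fun x => c * f x).
Proof.
move=> [iR iI]; split; under eq_fun do rewrite !ReImE.
- under eq_fun do rewrite EFinB !EFinM.
  by apply: integrableB => //; exact: integrableZl.
- under eq_fun do rewrite EFinD !EFinM.
  by apply: integrableD => //; exact: integrableZl.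
Qed.

Lemma cintZ c f : cintegrable D f -> cint D (fun x => c * f x) = c * cint D f.
Proof.
move=> [iR iI]; apply: complexP; rewrite !ReImE/= -!RintegralZl//.
- rewrite -RintegralB//; last 2 first.
  + exact: (integrableZl mD _ iR).
  + exact: (integrableZl mD _ iI).
  by apply: eq_Rintegral => x _; rewrite !ReImE.
- rewrite -RintegralD//; last 2 first.
  + exact: (integrableZl mD _ iI).
  + exact: (integrableZl mD _ iR).
  by apply: eq_Rintegral => x _; rewrite !ReImE.
Qed.

Lemma cintegrable0 : cintegrable D (fun=> 0).
Proof. by split; exact: integrable0. Qed.

Lemma cint0 : cint D (fun=> 0) = 0.
Proof. by apply: complexP => /=; rewrite /Rintegral integral0. Qed.

Lemma cintegrable_sum (I : Type) (r : seq I) (F : I -> T -> R[i]) :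
  (forall i, cintegrable D (F i)) -> cintegrable D (fun x => \sum_(i <- r) F i x).
Proof.
move=> iF; elim: r => [|i r IH].
  by apply: (eq_cintegrable mD _ cintegrable0) => x _; rewrite big_nil.
by apply: (eq_cintegrable mD _ (cintegrableD (iF i) IH)) => x _; rewrite big_cons.
Qed.

Lemma cint_sum (I : Type) (r : seq I) (F : I -> T -> R[i]) :
  (forall i, cintegrable D (F i)) ->
  cint D (fun x => \sum_(i <- r) F i x) = \sum_(i <- r) cint D (F i).
Proof.
move=> iF; elim: r => [|i r IH].
  by rewrite big_nil -[RHS]cint0; apply: eq_cint => x _; rewrite big_nil.
rewrite big_cons -IH -cintD//; last exact: cintegrable_sum.
by apply: eq_cint => x _; rewrite big_cons.
Qed.

Lemma cintB f g : cintegrable D f -> cintegrable D g ->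
  cint D (fun x => f x - g x) = cint D f - cint D g.
Proof.
move=> fi gi; rewrite -mulN1r -cintZ// -cintD//; last exact: cintegrableZ.
by apply: eq_cint => x _; rewrite mulN1r.
Qed.

Lemma cintegrable_norm1 f : cintegrable D f ->
  mu.-integrable D (EFin \o (fun x => `|complex.Re (f x)| + `|complex.Im (f x)|)).
Proof.
move=> [iR iI].
have := integrableD mD (integrable_norm iR) (integrable_norm iI).
by apply: eq_integrable => // x _.
Qed.

Lemma cintegrableM_bounded f k : cintegrable D f -> cmeas D k ->
  (exists M, forall x, D x -> normsq (k x) <= M) -> cintegrable D (fun x => f x * k x).
Proof.
move=> fi mk [M kM].
have ih := integrableZl mD (1 + M) (cintegrable_norm1 fi).
(* The inequality |r| <= 1 + r^2 avoids a square root of M. *)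
have bound x : D x -> `|complex.Re (k x)| <= 1 + M /\ `|complex.Im (k x)| <= 1 + M.
  move=> Dx; have := kM _ Dx; rewrite /normsq => h; split.
  - have := real_normK (num_real (complex.Re (k x))).
    have := normr_ge0 (complex.Re (k x)); have := sqr_ge0 (complex.Im (k x)).
    move: `|_| => n; nra.
  - have := real_normK (num_real (complex.Im (k x))).
    have := normr_ge0 (complex.Im (k x)); have := sqr_ge0 (complex.Re (k x)).
    move: `|_| => n; nra.
apply: (@cintegrable_le _ (fun x => (1 + M) *
  (`|complex.Re (f x)| + `|complex.Im (f x)|))).
- by apply: cmeasM => //; exact: cintegrable_meas.
- exact: eq_integrable ih.
- move=> x Dx; have [bR bI] := bound x Dx; rewrite !ReImE.
  rewrite (le_trans (ler_normB _ _))// !normrM mulrDr.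
  by rewrite lerD// mulrC ler_wpM2r.
- move=> x Dx; have [bR bI] := bound x Dx; rewrite !ReImE.
  rewrite (le_trans (ler_normD _ _))// !normrM mulrDr.
  by rewrite lerD// mulrC ler_wpM2r.
Qed.

Lemma L2onJ f : L2on D f -> L2on D (fun x => (conjc (f x))).
Proof.
move=> [mf fi]; split; first exact: cmeasJ.
by under eq_fun do rewrite normsqJ.
Qed.

Lemma L2on_le f (h : T -> R) : cmeas D f -> mu.-integrable D (EFin \o h) ->
  (forall x, D x -> normsq (f x) <= h x) -> L2on D f.
Proof.
move=> mf ih fh; split => //; apply: le_integrable ih => //.
  by apply/measurable_EFinP/measurable_normsq.
move=> x Dx; rewrite lee_fin ger0_norm ?normsq_ge0//.
by rewrite (le_trans (fh _ Dx))// ler_norm.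
Qed.

Lemma L2on_bounded f (M : R) : (mu D < +oo)%E -> cmeas D f ->
  (forall x, D x -> normsq (f x) <= M) -> L2on D f.
Proof. by move=> fD mf fM; apply: (L2on_le mf (integrable_cst M fD)). Qed.

Lemma L2onM_bounded f k : L2on D f -> cmeas D k ->
  (exists M, forall x, D x -> normsq (k x) <= M) -> L2on D (fun x => f x * k x).
Proof.
move=> [mf fi] mk [M kM].
apply: (@L2on_le _ (fun x => M * normsq (f x))); first exact: cmeasM.
- by have := integrableZl mD M fi; apply: eq_integrable.
- by move=> x Dx; rewrite normsqM mulrC ler_wpM2r ?normsq_ge0// kM.
Qed.

Lemma L2onZ c f : L2on D f -> L2on D (fun x => c * f x).
Proof.
move=> fi; apply: (eq_L2on mD (f := fun x => f x * c)); first by move=> x _; rewrite mulrC.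
by apply: (L2onM_bounded fi (cmeas_cst D c)); exists (normsq c).
Qed.

Lemma L2onN f : L2on D f -> L2on D (fun x => - f x).
Proof. by move=> /(L2onZ (-1)); apply: (eq_L2on mD) => x _; rewrite mulN1r. Qed.

Lemma L2onD f g : L2on D f -> L2on D g -> L2on D (fun x => f x + g x).
Proof.
move=> [mf fi] [mg gi].
apply: (@L2on_le _ (fun x => 2 * (normsq (f x) + normsq (g x)))).
- exact: cmeasD.
- by have := integrableZl mD 2 (integrableD mD fi gi); apply: eq_integrable.
- by move=> x _; exact: normsqD_le.
Qed.

Lemma L2onB f g : L2on D f -> L2on D g -> L2on D (fun x => f x - g x).
Proof. by move=> fi gi; apply: L2onD => //; exact: L2onN. Qed.

Lemma L2on0 : L2on D (fun=> 0).
Proof. by split; [exact: cmeas_cst|under eq_fun do rewrite normsq0; exact: integrable0]. Qed.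

Lemma L2on_sum (I : Type) (r : seq I) (F : I -> T -> R[i]) :
  (forall i, L2on D (F i)) -> L2on D (fun x => \sum_(i <- r) F i x).
Proof.
move=> iF; elim: r => [|i r IH].
  by apply: (eq_L2on mD _ L2on0) => x _; rewrite big_nil.
by apply: (eq_L2on mD _ (L2onD (iF i) IH)) => x _; rewrite big_cons.
Qed.

Lemma L2on_mulJ f g : L2on D f -> L2on D g -> cintegrable D (fun x => f x * (conjc (g x))).
Proof.
move=> [mf fi] [mg gi].
apply: (@cintegrable_le _ (fun x => normsq (f x) + normsq (g x))).
- by apply: cmeasM => //; exact: cmeasJ.
- by have := integrableD mD fi gi; apply: eq_integrable.
- by move=> x _; exact: Re_le_normsq.
- by move=> x _; exact: Im_le_normsq.
Qed.

Lemma L2on_mul f g : L2on D f -> L2on D g -> cintegrable D (fun x => f x * g x).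
Proof.
move=> fi /L2onJ gi; apply: (eq_cintegrable mD _ (L2on_mulJ fi gi)) => x _.
by rewrite /= conjcK.
Qed.

Lemma nrm_ge0 f : 0 <= nrm D f.
Proof. by apply: Rintegral_ge0 => x _; exact: normsq_ge0. Qed.

Lemma nrmE f : L2on D f -> (\int[mu]_(x in D) (normsq (f x))%:E)%E = (nrm D f)%:E.
Proof. by move=> [mf fi]; rewrite /nrm /Rintegral fineK//; exact: integrable_fin_num. Qed.

Lemma nrmN f : nrm D (fun x => - f x) = nrm D f.
Proof. by apply: eq_nrm => x _; rewrite normsqN. Qed.

Lemma nrmJ f : nrm D (fun x => (conjc (f x))) = nrm D f.
Proof. by apply: eq_nrm => x _; rewrite normsqJ. Qed.

Lemma nrmZ c f : L2on D f -> nrm D (fun x => c * f x) = normsq c * nrm D f.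
Proof.
move=> [mf fi]; rewrite /nrm -RintegralZl//; apply: eq_Rintegral => x _.
by rewrite normsqM.
Qed.

Lemma nrmD f g : L2on D f -> L2on D g -> nrm D (fun x => f x + g x) =
  nrm D f + nrm D g + 2 * complex.Re (cint D (fun x => f x * (conjc (g x)))).
Proof.
move=> fi gi; have [iR iI] := L2on_mulJ fi gi; case: fi => mf fi; case: gi => mg gi.
rewrite /cint/= -RintegralZl// /nrm -RintegralD// -RintegralD//.
- by apply: eq_Rintegral => x _; rewrite normsqD.
- by have := integrableD mD fi gi; apply: eq_integrable.
- by have := integrableZl mD 2 iR; apply: eq_integrable.
Qed.

(** Replaces the triangle inequality. Two errors of size e / 4 add up to 2 (e / 4 + e / 4) = e, the
    split used in every density argument below. *)
Lemma nrmD_le f g : L2on D f -> L2on D g ->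
  nrm D (fun x => f x + g x) <= 2 * (nrm D f + nrm D g).
Proof.
move=> fi gi; case: (fi) => mf fi'; case: (gi) => mg gi'.
rewrite /nrm -RintegralD// -RintegralZl//; last first.
  by have := integrableD mD fi' gi'; apply: eq_integrable.
apply: le_Rintegral => //.
- by have [] := L2onD fi gi.
- by have := integrableZl mD 2 (integrableD mD fi' gi'); apply: eq_integrable.
- by move=> x _; exact: normsqD_le.
Qed.

End fixed_domain.
End complex_integral.
Arguments eq_cint {d T R mu D f g}.
Arguments eq_nrm {d T R mu D f g}.

Section exponentials.
Context {R : realType}.
Notation mu := (@lebesgue_measure R).
Implicit Types (a b : R) (z : R[i]).

Lemma Re_cexpM x z : complex.Re (cexp (x%:C * z)) =
  expR (complex.Re z * x) * cos (complex.Im z * x).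
Proof. by rewrite /= !ReImE/= !mul0r subr0 addr0 !(mulrC x). Qed.

Lemma Im_cexpM x z : complex.Im (cexp (x%:C * z)) =
  expR (complex.Re z * x) * sin (complex.Im z * x).
Proof. by rewrite /= !ReImE/= !mul0r subr0 addr0 !(mulrC x). Qed.

Lemma is_derive_mull (q x : R) : is_derive x 1 (fun y : R => q * y) q.
Proof.
have := is_deriveZ q (is_derive_id x (1 : R)).
by move=> h; apply: (is_derive_eq h); rewrite /GRing.scale/= mulr1.
Qed.

Lemma is_derive_expcos (p q x : R) :
  is_derive x 1 (fun x : R => expR (p * x) * cos (q * x))
    (p * (expR (p * x) * cos (q * x)) - q * (expR (p * x) * sin (q * x))).
Proof.
have h1 := is_derive1_comp (is_derive_expR (p * x)) (is_derive_mull p x).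
have h2 := is_derive1_comp (is_derive_cos (q * x)) (is_derive_mull q x).
apply: (is_derive_eq (is_deriveM h1 h2)).
by rewrite /GRing.scale/=; ring.
Qed.

Lemma is_derive_expsin (p q x : R) :
  is_derive x 1 (fun x : R => expR (p * x) * sin (q * x))
    (p * (expR (p * x) * sin (q * x)) + q * (expR (p * x) * cos (q * x))).
Proof.
have h1 := is_derive1_comp (is_derive_expR (p * x)) (is_derive_mull p x).
have h2 := is_derive1_comp (is_derive_sin (q * x)) (is_derive_mull q x).
apply: (is_derive_eq (is_deriveM h1 h2)).
by rewrite /GRing.scale/=; ring.
Qed.

Lemma is_derive_continuous (f df : R -> R) :
  (forall x, is_derive x (1 : R) f (df x)) -> continuous f.
Proof. by move=> h x; apply: differentiable_continuous; apply/derivable1_diffP; case: (h x). Qed.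

Lemma continuous_expcos (p q : R) : continuous (fun x : R => expR (p * x) * cos (q * x)).
Proof. apply: is_derive_continuous => x; exact: is_derive_expcos. Qed.

Lemma continuous_expsin (p q : R) : continuous (fun x : R => expR (p * x) * sin (q * x)).
Proof. apply: is_derive_continuous => x; exact: is_derive_expsin. Qed.

Lemma Rintegral_is_derive (f F : R -> R) a b : a < b -> continuous f ->
  (forall x, is_derive x (1 : R) F (f x)) ->
  Rintegral mu `[a, b] f = F b - F a.
Proof.
move=> ab cf dF; have cF := is_derive_continuous dF.
rewrite /Rintegral (continuous_FTC2 (F := F) ab)//.
- exact: continuous_subspaceT.
- split=> [x _||]; first by case: (dF x).
  + by apply: cvg_at_right_filter; exact: cF.
  + by apply: cvg_at_left_filter; exact: cF.
- by move=> x _; rewrite derive1E; case: (dF x).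
Qed.

Lemma cmeas_cexpM D z : measurable D -> cmeas D (fun x : R => cexp (x%:C * z)).
Proof.
move=> mD; split; apply: (@measurable_funS _ _ _ _ setT) => //;
  apply: continuous_measurable_fun.
- by under eq_fun do rewrite Re_cexpM; exact: continuous_expcos.
- by under eq_fun do rewrite Im_cexpM; exact: continuous_expsin.
Qed.

Lemma cintegrable_cexpM a b z : cintegrable mu `[a, b] (fun x : R => cexp (x%:C * z)).
Proof.
split; apply: (@continuous_compact_integrable R _ `[a, b]);
  (try exact: segment_compact); apply: continuous_subspaceT.
- by under eq_fun do rewrite Re_cexpM; exact: continuous_expcos.
- by under eq_fun do rewrite Im_cexpM; exact: continuous_expsin.
Qed.

(** The factor z stays on the left instead of being divided out, so z = 0 needs no separate
    treatment. The two components are instances of the fundamental theorem of calculus. *)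
Lemma cint_cexpM a b z : a < b ->
  z * cint mu `[a, b] (fun x : R => cexp (x%:C * z)) =
  cexp (b%:C * z) - cexp (a%:C * z).
Proof.
move=> ab; rewrite -cintZ//; last exact: cintegrable_cexpM.
apply: complexP.
- rewrite Re_cint cReD cReN !Re_cexpM.
  rewrite -(@Rintegral_is_derive _ (fun x => expR (complex.Re z * x) * cos (complex.Im z * x))
    _ _ ab _ (is_derive_expcos (complex.Re z) (complex.Im z))).
  + by apply: eq_Rintegral => x _; rewrite cReM Re_cexpM Im_cexpM.
  + by move=> x; apply: cvgB; apply: cvgMl_tmp; [exact: continuous_expcos|exact: continuous_expsin].
- rewrite Im_cint cImD cImN !Im_cexpM.
  rewrite -(@Rintegral_is_derive _ (fun x => expR (complex.Re z * x) * sin (complex.Im z * x))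
    _ _ ab _ (is_derive_expsin (complex.Re z) (complex.Im z))).
  + by apply: eq_Rintegral => x _; rewrite cImM Re_cexpM Im_cexpM.
  + by move=> x; apply: cvgD; apply: cvgMl_tmp; [exact: continuous_expsin|exact: continuous_expcos].
Qed.

(** Reconciles the open periods of the Fourier series with the closed intervals of the fundamental
    theorem of calculus. *)
Lemma cint_itv_bndoo a b (b0 b1 : bool) (f : R -> R[i]) : cmeas `]a, b[ f ->
  cint mu [set` Interval (BSide b0 a) (BSide b1 b)] f = cint mu `]a, b[ f.
Proof.
by move=> [fR fI]; apply: complexP; rewrite ?Re_cint ?Im_cint /Rintegral
  (integral_itv_bndoo b0 b1)//; apply/measurable_EFinP.
Qed.

Lemma eeE x y : ee (x * y) = cexp (x%:C * (0 +i* (2 * pi * y))) :> R[i].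
Proof. by congr cexp; apply: complexP; rewrite !ReImE/=; ring. Qed.

Lemma cmeas_ee D y : measurable D -> cmeas D (fun x : R => ee (x * y)).
Proof. by move=> mD; under [X in cmeas _ X]eq_fun do rewrite eeE; exact: cmeas_cexpM. Qed.

End exponentials.

(** * Parseval's identity for Fourier series *)

Section trigonometric_system.
Context {R : realType}.
Notation mu := (@lebesgue_measure R).
Variables (c T : R).
Hypothesis T0 : 0 < T.
Notation I := (`]c, c + T[%classic : set R).

Definition en (n : int) (t : R) : R[i] := ee (t * (n%:~R / T)).

(** Neither [en] nor [coef] is normalised: each exponential has squared norm T, which is the source
    of the factors T and 1 / T in Bessel and Parseval. *)
Definition coef (f : R -> R[i]) (n : int) : R[i] :=
  cint mu I (fun t => f t * conjc (en n t)).

Let mI : measurable (I : set (measurableTypeR R)). Proof. exact: measurable_itv. Qed.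

Lemma period_length : mu I = T%:E.
Proof. by rewrite lebesgue_measure_itv/= lte_fin ltrDl T0 -EFinD addrAC subrr add0r. Qed.

Lemma finite_period : (mu I < +oo)%E.
Proof. by rewrite period_length ltry. Qed.

Lemma Rintegral_period1 : Rintegral mu I (fun=> 1) = T.
Proof. by rewrite Rintegral_cst// mul1r; exact: (congr1 fine period_length). Qed.

Lemma cmeas_en D n : measurable D -> cmeas D (en n).
Proof. exact: cmeas_ee. Qed.

Lemma L2on_en n : L2on mu I (en n).
Proof. by apply: (@L2on_bounded _ _ _ mu I mI _ 1) => [||t _]; [exact: finite_period|exact: cmeas_en|rewrite normsq_ee]. Qed.

Lemma en_mulJ n m t : en n t * conjc (en m t) = en (n - m) t.
Proof. by rewrite /en eeJ -eeD; congr ee; rewrite rmorphB/=; ring. Qed.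

Lemma en_mul n m t : en n t * en m t = en (n + m) t.
Proof. by rewrite /en -eeD; congr ee; rewrite rmorphD/=; ring. Qed.

Lemma cint_cst (z : R[i]) : cint mu I (fun=> z) = z * T%:C.
Proof.
have i1 : cintegrable mu I (fun=> 1).
  by split; [exact: (@integrable_cst _ _ _ mu I mI 1 finite_period)|exact: (@integrable_cst _ _ _ mu I mI 0 finite_period)].
rewrite -[in LHS](mulr1 z) cintZ//; congr (_ * _); apply: complexP => /=; first exact: Rintegral_period1.
by rewrite /Rintegral integral0.
Qed.

Lemma coef_en n m : coef (en n) m = if n == m then T%:C else 0.
Proof.
rewrite /coef (@eq_cint _ _ _ mu I _ (en (n - m))); last by move=> t _; rewrite en_mulJ.
case: eqVneq => [->|nm].
  rewrite (@eq_cint _ _ _ mu I _ (fun=> 1)) ?cint_cst ?mul1r// => t _.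
  by rewrite subrr /en mul0r mulr0 ee0.
set z := 0 +i* (2 * pi * ((n - m)%:~R / T)).
have z0 : z != 0.
  have nm0 : (n - m)%:~R != 0 :> R by rewrite intr_eq0 subr_eq0.
  rewrite eq_complex/= eqxx/= mulf_neq0//; last by rewrite mulf_neq0 ?nm0// invr_eq0 gt_eqF.
  by rewrite mulf_neq0 ?gt_eqF ?pi_gt0.
have cT : c < c + T by rewrite ltrDl.
(* The exponential takes the same value at both ends of the period, so z times the integral
   vanishes, while z itself does not. *)
apply: (mulfI z0); rewrite mulr0.
have := cint_cexpM z cT; have -> : cexp ((c + T)%:C * z) = cexp (c%:C * z).
  have eT : ee (T * ((n - m)%:~R / T)) = 1 :> R[i].
    by rewrite mulrC divfK ?gt_eqF// ee_int.
  have -> : (c + T)%:C * z = c%:C * z + T%:C * z by rewrite rmorphD mulrDl.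
  by rewrite cexpD /z -[cexp (T%:C * _)]eeE eT mulr1.
rewrite subrr => <-; congr (_ * _).
rewrite -(@cint_itv_bndoo _ c (c + T) true false); last exact: cmeas_en.
by apply: eq_cint => t _; rewrite /en eeE.
Qed.

Lemma coefB_sum f s (a : int -> R[i]) n : L2on mu I f ->
  coef (fun t => f t - \sum_(m <- s) a m * en m t) n =
  coef f n - \sum_(m <- s) a m * (if m == n then T%:C else 0).
Proof.
move=> fi; rewrite /coef.
rewrite (@eq_cint _ _ _ mu I _ (fun t => f t * conjc (en n t) -
    \sum_(m <- s) a m * (en m t * conjc (en n t)))); last first.
  move=> t _; rewrite mulrBl mulr_suml; congr (_ - _).
  by apply: eq_bigr => m _; rewrite mulrA.
have ie m : cintegrable mu I (fun t => a m * (en m t * conjc (en n t))).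
  by apply: cintegrableZ => //; apply: L2on_mulJ => //; exact: L2on_en.
rewrite cintB//; last 2 first.
- by apply: L2on_mulJ => //; exact: L2on_en.
- exact: cintegrable_sum.
congr (_ - _); rewrite cint_sum//; apply: eq_bigr => m _.
rewrite cintZ//; last by apply: L2on_mulJ => //; exact: L2on_en.
by congr (_ * _); exact: coef_en.
Qed.

Lemma L2on_trig s (a : int -> R[i]) : L2on mu I (fun t => \sum_(m <- s) a m * en m t).
Proof. by apply: L2on_sum => // m; apply: L2onZ => //; exact: L2on_en. Qed.

(** By orthogonality, subtracting the terms indexed by s does not change the coefficient at a
    frequency n outside s. Each new frequency thus contributes independently of the earlier ones,
    and induction on s applies. *)
Lemma nrmB_trig f s (a : int -> R[i]) : L2on mu I f -> uniq s ->
  nrm mu I (fun t => f t - \sum_(m <- s) a m * en m t) = nrm mu I f +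
    \sum_(m <- s) (T * normsq (a m) - 2 * complex.Re (coef f m * conjc (a m))).
Proof.
move=> fi; elim: s => [_|n s IH /= /andP[ns us]].
  by rewrite big_nil addr0; apply: eq_nrm => t _; rewrite big_nil subr0.
rewrite big_cons addrCA -IH// => {IH}.
rewrite [LHS](@eq_nrm _ _ _ mu I _ (fun t => (f t - \sum_(m <- s) a m * en m t) + - a n * en n t));
  last first.
  by move=> t _; rewrite big_cons; congr normsq; ring.
have gi := L2onB mI fi (L2on_trig s a).
rewrite nrmD//; last by apply: L2onZ => //; exact: L2on_en.
rewrite nrmZ//; last exact: L2on_en.
have -> : nrm mu I (en n) = T.
  rewrite /nrm (@eq_Rintegral _ _ _ mu I (fun=> 1)); last by move=> t _; rewrite /= normsq_ee.
  exact: Rintegral_period1.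
have -> : cint mu I (fun t => (f t - \sum_(m <- s) a m * en m t) *
    conjc (- a n * en n t)) = - conjc (a n) * coef f n.
  rewrite (@eq_cint _ _ _ mu I _ (fun t => - conjc (a n) *
      ((f t - \sum_(m <- s) a m * en m t) * conjc (en n t)))); last first.
    by move=> t _; rewrite rmorphM rmorphN/= mulrCA.
  rewrite cintZ//; last by apply: L2on_mulJ => //; exact: L2on_en.
  congr (_ * _); rewrite -[LHS]/(coef (fun t => f t - \sum_(m <- s) a m * en m t) n).
  rewrite coefB_sum// big_seq big1 ?subr0// => m ms; case: eqP => [mn|]; last by rewrite mulr0.
  by rewrite -mn ms in ns.
by rewrite normsqN !ReImE; ring.
Qed.

(** Completing the square: T |a|^2 - 2 Re (c conj a) >= - |c|^2 / T, with equality at a = c / T. Any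
    trigonometric polynomial, however found, thus gives a lower bound on the sum of the squared
    coefficients. *)
Lemma bessel_approx f s (a : int -> R[i]) : L2on mu I f -> uniq s ->
  nrm mu I f - T^-1 * \sum_(m <- s) normsq (coef f m) <=
  nrm mu I (fun t => f t - \sum_(m <- s) a m * en m t).
Proof.
move=> fi us; rewrite nrmB_trig// lerD2l mulr_sumr -sumrN ler_sum// => m _.
rewrite -(ler_pM2l T0) mulrN mulrA mulfV ?gt_eqF// mul1r.
have := normsq_ge0 (coef f m - T%:C * a m).
by rewrite /normsq !ReImE/= !mul0r subr0 addr0; nra.
Qed.

Lemma bessel f s : L2on mu I f -> uniq s ->
  \sum_(m <- s) normsq (coef f m) <= T * nrm mu I f.
Proof.
move=> fi us; have := nrmB_trig (fun m => T^-1%:C * coef f m) fi us.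
have := nrm_ge0 mu I (fun t => f t - \sum_(m <- s) T^-1%:C * coef f m * en m t).
move=> /[swap] ->.
under eq_bigr => m _.
  have -> : T * normsq (T^-1%:C * coef f m) - 2 *
      complex.Re (coef f m * conjc (T^-1%:C * coef f m)) = - (T^-1 * normsq (coef f m)).
    by rewrite normsqM normsqC /normsq !ReImE/=; field; rewrite gt_eqF.
  over.
rewrite sumrN -mulr_sumr subr_ge0 -(ler_pM2l T0).
by rewrite mulrA mulfV ?gt_eqF// mul1r.
Qed.

End trigonometric_system.

Section dominated.
Context d {T : measurableType d} {R : realType}.
Variable mu : {measure set T -> \bar R}.

Lemma nrm_cvg0 (D : set T) (F : nat -> T -> R[i]) (g : T -> R) (e : R) :
  measurable D -> (forall n, cmeas D (F n)) -> mu.-integrable D (EFin \o g) ->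
  (forall n x, D x -> normsq (F n x) <= g x) ->
  (forall x, D x -> (fun n => normsq (F n x)) @ \oo --> 0) ->
  0 < e -> exists n, nrm mu D (F n) <= e.
Proof.
move=> mD mF ig Fg F0 e0.
have h : (fun n => \int[mu]_(x in D) (normsq (F n x))%:E)%E @ \oo --> 0%E.
  rewrite -(integral0 mu D).
  apply: (@dominated_cvg _ _ _ mu _ mD (fun n x => (normsq (F n x))%:E) (cst 0%E) (EFin \o g)) => //.
  - by move=> n; exact: measurable_normsqE.
  - move=> x Dx; apply: cvg_EFin; first by near=> n.
    exact: F0.
  - by move=> n x Dx; rewrite gee0_abs ?lee_fin ?normsq_ge0// Fg.
have /cvgrPdist_le /(_ _ e0) [n _ /(_ n (leqnn n))] : (fun n => nrm mu D (F n)) @ \oo --> 0.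
  exact: (fine_cvg h).
rewrite sub0r normrN ger0_norm ?nrm_ge0// => ?; by exists n.
Unshelve. all: by end_near. Qed.
End dominated.

(** * Powers that converge to a jump function *)

Section power_limits.
Context {R : realType}.

Lemma bernoulli_add (q : R) n : 0 <= q -> 1 + n%:R * q <= (1 + q) ^+ n.
Proof.
move=> q0; elim: n => [|n IH]; first by rewrite mul0r addr0 expr0.
have h : 0 <= 1 + q by rewrite addr_ge0.
rewrite exprS -natr1; apply: (le_trans _ (ler_wpM2l h IH)).
have := mulr_ge0 (ler0n R n) (sqr_ge0 q); rewrite expr2; nra.
Qed.

(** With s the square root of r, write n r^n = (n s^n) s^n. Bernoulli's inequality for 1 / s bounds
    the first factor, and the second tends to 0. *)
Lemma cvg_nat_geometric (r : R) : 0 <= r < 1 -> (fun n => n%:R * r ^+ n) @ \oo --> 0.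
Proof.
move=> /andP[r0 r1].
have [->|rn0] := eqVneq r 0.
  apply: cvg_near_cst; exists 1%N => //= n n0 /=.
  by rewrite expr0n gtn_eqF// mulr0.
pose s := Num.sqrt r.
have s0 : 0 < s by rewrite sqrtr_gt0 lt_neqAle eq_sym rn0.
have s1 : s < 1 by rewrite -sqrtr1 ltr_sqrt.
have ss : s * s = r by rewrite -expr2 sqr_sqrtr.
pose M := (s^-1 - 1)^-1.
have h0 : 0 < s^-1 - 1 by rewrite subr_gt0 invf_gt1.
have bern n : n%:R * s ^+ n <= M.
  have hn : 1 + n%:R * (s^-1 - 1) <= (s^-1) ^+ n.
    by have := bernoulli_add n (ltW h0); rewrite addrCA subrr addr0.
  rewrite -(ler_pM2r h0) mulVf ?gt_eqF// mulrAC -ler_pdivlMr ?exprn_gt0//.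
  by rewrite mul1r -exprVn (le_trans _ hn)// lerDr.
apply: (@squeeze_cvgr _ _ _ _ (fun=> 0) (fun n => geometric M s n)).
- near=> n; rewrite mulr_ge0 ?exprn_ge0//= -ss exprMn mulrA.
  by rewrite ler_wpM2r ?exprn_ge0// ltW.
- exact: cvg_cst.
- by apply: cvg_geometric; rewrite ger0_norm// ltW.
Unshelve. all: by end_near. Qed.

(* The exponent K ~ (n + 1) / k^n makes (1 - u^n)^K a sharp threshold at u = k. *)
Definition threshold (k : R) (n : nat) (u : R) : R :=
  (1 - u ^+ n) ^+ Num.truncn (n.+1%:R / k ^+ n).

Lemma threshold_ge0 k n u : 0 <= u <= 1 -> 0 <= threshold k n u.
Proof.
by move=> /andP[u0 u1]; rewrite exprn_ge0// subr_ge0 exprn_ile1.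
Qed.

Lemma threshold_le1 k n u : 0 <= u <= 1 -> threshold k n u <= 1.
Proof.
move=> /andP[u0 u1]; rewrite exprn_ile1 ?subr_ge0 ?exprn_ile1//.
by rewrite lerBlDr lerDl exprn_ge0.
Qed.

Lemma bernoulli_ge (x : R) K : 0 <= x <= 1 -> 1 - K%:R * x <= (1 - x) ^+ K.
Proof.
move=> /andP[x0 x1]; elim: K => [|K IH]; first by rewrite mul0r subr0 expr0.
rewrite exprS -natr1; have h : 0 <= 1 - x by rewrite subr_ge0.
apply: (le_trans _ (ler_wpM2l h IH)).
have := mulr_ge0 (ler0n R K) (sqr_ge0 x); rewrite expr2; nra.
Qed.

(** One step of the induction is (1 + (K + 1) x) (1 - x) <= 1 + K x. The result is the decay (1 -
    x)^K <= 1 / (1 + K x). *)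
Lemma bernoulli_le (x : R) K : 0 <= x <= 1 -> (1 + K%:R * x) * (1 - x) ^+ K <= 1.
Proof.
move=> /andP[x0 x1]; elim: K => [|K IH]; first by rewrite mul0r addr0 expr0 mulr1.
apply: le_trans IH; rewrite exprS -natr1 mulrA ler_wpM2r ?exprn_ge0 ?subr_ge0//.
have := mulr_ge0 (ler0n R K) (sqr_ge0 x); have := sqr_ge0 x; rewrite expr2; nra.
Qed.

(** Let K be the exponent. For u < k, K u^n <= (n + 1) (u / k)^n tends to 0, so the power tends to
    1. For u >= k, 1 + K u^n >= n + 1, so the power is at most 1 / (n + 1). The factor n + 1 in the
    exponent settles the boundary case u = k. *)
Lemma threshold_cvg (k u : R) : 0 < k -> 0 <= u <= 1 ->
  (fun n => threshold k n u) @ \oo --> ((u < k)%R%:R : R).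
Proof.
move=> k0 /andP[u0 u1].
have kn n : 0 < k ^+ n by rewrite exprn_gt0.
have un n : 0 <= u ^+ n <= 1 by rewrite exprn_ge0 ?exprn_ile1.
have K0 n : 0 <= n.+1%:R / k ^+ n :> R by rewrite divr_ge0// ltW.
case: ltP => uk /=.
  apply: (@squeeze_cvgr _ _ _ _ (fun n => 1 - n.+1%:R * (u / k) ^+ n) (fun=> 1)).
  - near=> n; rewrite threshold_le1 ?u0// andbT.
    apply: le_trans (bernoulli_ge _ (un n)); rewrite lerD2l lerN2.
    rewrite exprMn exprVn (mulrC (u ^+ n)) mulrA ler_wpM2r//.
      by case/andP: (un n).
    by rewrite truncn_le.
  - rewrite -[X in _ --> X]subr0; apply: cvgB; first exact: cvg_cst.
    have r1 : 0 <= u / k < 1 by rewrite divr_ge0 ?(ltW k0)//= ltr_pdivrMr// mul1r.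
    have -> : (fun n => n.+1%:R * (u / k) ^+ n) =
        (fun n => n%:R * (u / k) ^+ n) \+ (fun n => (u / k) ^+ n).
      by apply/funext => n /=; rewrite -natr1 mulrDl mul1r.
    have r2 : `|u / k| < 1 by case/andP: r1 => r0 ?; rewrite ger0_norm.
    by rewrite -[X in _ --> X](addr0 0); exact: (cvgD (cvg_nat_geometric r1) (cvg_expr r2)).
  - exact: cvg_cst.
apply: (@squeeze_cvgr _ _ _ _ (fun=> 0) (@harmonic R)).
- near=> n; rewrite threshold_ge0 ?u0//=.
  have n0 : 0 < n.+1%:R :> R by rewrite ltr0n.
  rewrite -div1r ler_pdivlMr// mulrC (le_trans _ (bernoulli_le (Num.truncn (n.+1%:R / k ^+ n)) (un n)))//.
  rewrite ler_wpM2r ?threshold_ge0 ?u0//.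
  have h := truncnS_gt (n.+1%:R / k ^+ n).
  (* Truncation rounds down, so the comparison holds for K + 1 rather than K. The surplus u^n <= 1
     is absorbed by the 1 in 1 + K u^n. *)
  have h2 : n.+1%:R <= (Num.truncn (n.+1%:R / k ^+ n)).+1%:R * u ^+ n.
    apply: (@le_trans _ _ (n.+1%:R / k ^+ n * u ^+ n)); last first.
      by apply: ler_wpM2r; [case/andP: (un n)|exact: ltW].
    rewrite -mulrA ler_peMr// mulrC ler_pdivlMr// mul1r lerXn2r// nnegrE ltW//.
  rewrite (le_trans h2)// -natr1 mulrDl mul1r addrC lerD2r.
  by case/andP: (un n).
- exact: cvg_cst.
- exact: cvg_harmonic.
Unshelve. all: by end_near. Qed.

End power_limits.

(** * The L^2 closure of the trigonometric polynomials on one period *)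

Section trigonometric_density.
Context {R : realType}.
Notation mu := (@lebesgue_measure R).
Variables (c T : R).
Hypothesis T0 : 0 < T.
Notation I := (`]c, c + T[%classic : set R).

Let mI : measurable (I : set (measurableTypeR R)). Proof. exact: measurable_itv. Qed.

(** Repeated frequencies are allowed in the list, so sums and products are plain list operations.
    Bessel's inequality needs distinct frequencies, and [trigpoly_uniq] provides them. *)
Definition trigpoly (p : R -> R[i]) := exists r : seq (R[i] * int),
  forall t, p t = \sum_(x <- r) x.1 * en T x.2 t.

Lemma en0 t : en T 0 t = 1.
Proof. by rewrite /en mul0r mulr0 ee0. Qed.

Lemma eq_trigpoly p q : p =1 q -> trigpoly p -> trigpoly q.
Proof. by move=> pq [r rE]; exists r => t; rewrite -pq. Qed.

Lemma trigpoly_cst z : trigpoly (fun=> z).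
Proof. by exists [:: (z, 0)] => t; rewrite big_seq1 en0 mulr1. Qed.

Lemma trigpoly_en n : trigpoly (en T n).
Proof. by exists [:: (1, n)] => t; rewrite big_seq1 mul1r. Qed.

Lemma trigpolyD p q : trigpoly p -> trigpoly q -> trigpoly (fun t => p t + q t).
Proof. by move=> [r rE] [s sE]; exists (r ++ s) => t; rewrite big_cat rE sE. Qed.

Lemma trigpolyM p q : trigpoly p -> trigpoly q -> trigpoly (fun t => p t * q t).
Proof.
move=> [r rE] [s sE].
exists [seq (x.1 * y.1, x.2 + y.2) | x <- r, y <- s] => t.
rewrite big_allpairs_dep rE sE mulr_suml; apply: eq_bigr => x _.
rewrite mulr_sumr; apply: eq_bigr => y _ /=.
by rewrite -en_mul; ring.
Qed.

Lemma trigpolyX p k : trigpoly p -> trigpoly (fun t => p t ^+ k).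
Proof.
move=> tp; elim: k => [|k IH].
  by apply: eq_trigpoly (trigpoly_cst 1) => t; rewrite expr0.
by apply: eq_trigpoly (trigpolyM tp IH) => t; rewrite exprS.
Qed.

Lemma trigpoly_uniq p : trigpoly p -> exists (s : seq int) (a : int -> R[i]),
  uniq s /\ forall t, p t = \sum_(n <- s) a n * en T n t.
Proof.
move=> [r rE]; exists (undup (map snd r)), (fun n => \sum_(x <- r | x.2 == n) x.1).
split; first exact: undup_uniq.
move=> t; rewrite rE.
under [RHS]eq_bigr do rewrite mulr_suml.
rewrite (exchange_big_dep xpredT)//= big_seq [RHS]big_seq; apply: eq_bigr => x xr.
rewrite big_mkcond (bigD1_seq x.2) ?undup_uniq ?mem_undup ?map_f//= eqxx.
rewrite big1 ?addr0// => n nx; by rewrite eq_sym (negPf nx).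
Qed.

Lemma L2on_trigpoly p : trigpoly p -> L2on mu I p.
Proof.
move=> /trigpoly_uniq[s [a [_ pE]]].
by apply: (eq_L2on mI _ (L2on_trig c T0 s a)) => t _; rewrite pE.
Qed.

(** Membership in the L^2 closure of the trigonometric polynomials. The aim is to show, in
    [trig_dense_L2], that this closure is the whole space. *)
Definition trig_dense f := L2on mu I f /\ forall e : R, 0 < e ->
  exists p, trigpoly p /\ nrm mu I (fun t => f t - p t) <= e.

Lemma trig_denseP f : L2on mu I f -> (forall e : R, 0 < e ->
  exists g, trig_dense g /\ nrm mu I (fun t => f t - g t) <= e) -> trig_dense f.
Proof.
move=> fi fg; split => // e e0.
have e4 : 0 < e / 4 by rewrite divr_gt0.
have [g [[gi gp] fge]] := fg _ e4.
have [p [tp gpe]] := gp _ e4.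
exists p; split => //.
have := nrmD_le mI (L2onB mI fi gi) (L2onB mI gi (L2on_trigpoly tp)).
rewrite (@eq_nrm _ _ _ mu I _ (fun t => f t - p t)); last first.
  by move=> t _; congr normsq; ring.
by move=> h; apply: (le_trans h); lra.
Qed.

Lemma trig_dense_trigpoly p : trigpoly p -> trig_dense p.
Proof.
move=> tp; split; first exact: L2on_trigpoly.
move=> e e0; exists p; split => //; apply: (le_trans _ (ltW e0)).
rewrite /nrm (@eq_Rintegral _ _ _ mu I (fun=> 0)); last first.
  by move=> t _; rewrite subrr normsq0.
by rewrite /Rintegral integral0.
Qed.

Lemma eq_trig_dense f g : (forall t, I t -> f t = g t) -> trig_dense f -> trig_dense g.
Proof.
move=> fg [fi fp]; split; first exact: eq_L2on fi.
move=> e e0; have [p [tp pe]] := fp _ e0; exists p; split => //.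
by rewrite -(@eq_nrm _ _ _ mu I (fun t => f t - p t))// => t It; rewrite fg.
Qed.

Lemma trig_denseD f g : trig_dense f -> trig_dense g -> trig_dense (fun t => f t + g t).
Proof.
move=> [fi fp] [gi gp]; split; first exact: L2onD.
move=> e e0; have e4 : 0 < e / 4 by rewrite divr_gt0.
have [p [tp pe]] := fp _ e4; have [q [tq qe]] := gp _ e4.
exists (fun t => p t + q t); split; first exact: trigpolyD.
have := nrmD_le mI (L2onB mI fi (L2on_trigpoly tp)) (L2onB mI gi (L2on_trigpoly tq)).
rewrite (@eq_nrm _ _ _ mu I _ (fun t => f t + g t - (p t + q t))); last first.
  by move=> t _; congr normsq; ring.
by move=> h; apply: (le_trans h); lra.
Qed.

Lemma trig_denseZ z f : trig_dense f -> trig_dense (fun t => z * f t).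
Proof.
move=> [fi fp]; split; first exact: L2onZ.
(* Dividing by 1 + |z|^2 rather than |z|^2 covers z = 0. *)
move=> e e0; have z0 : 0 < 1 + normsq z by have := normsq_ge0 z; lra.
have [p [tp pe]] := fp _ (divr_gt0 e0 z0).
exists (fun t => z * p t); split; first by apply: trigpolyM => //; exact: trigpoly_cst.
rewrite (@eq_nrm _ _ _ mu I _ (fun t => z * (f t - p t))); last first.
  by move=> t _; congr normsq; ring.
rewrite nrmZ//; last by apply: L2onB => //; exact: L2on_trigpoly.
move: pe; rewrite ler_pdivlMr// => pe; apply: le_trans pe.
rewrite mulrC; apply: ler_wpM2l; first exact: nrm_ge0.
by rewrite lerDr.
Qed.

Lemma trig_dense0 : trig_dense (fun=> 0).
Proof. exact/trig_dense_trigpoly/trigpoly_cst. Qed.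

Lemma trig_denseB f g : trig_dense f -> trig_dense g -> trig_dense (fun t => f t - g t).
Proof.
move=> df dg; have := trig_denseD df (trig_denseZ (-1) dg).
by apply: eq_trig_dense => t _; rewrite mulN1r.
Qed.

Lemma trig_dense_sum (J : Type) (r : seq J) (F : J -> R -> R[i]) :
  (forall j, trig_dense (F j)) -> trig_dense (fun t => \sum_(j <- r) F j t).
Proof.
move=> dF; elim: r => [|j r IH].
  by apply: eq_trig_dense trig_dense0 => t _; rewrite big_nil.
by apply: eq_trig_dense (trig_denseD (dF j) IH) => t _; rewrite big_cons.
Qed.

Lemma trig_dense_cvg (F : nat -> R -> R[i]) f (g : R -> R) :
  (forall n, trig_dense (F n)) -> cmeas (I : set (measurableTypeR R)) f ->
  mu.-integrable I (EFin \o g) ->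
  (forall n t, I t -> normsq (f t - F n t) <= g t) ->
  L2on mu I f ->
  (forall t, I t -> (fun n => normsq (f t - F n t)) @ \oo --> 0) -> trig_dense f.
Proof.
move=> dF mf ig Fg fi F0; apply: trig_denseP => // e e0.
have mFn n : cmeas (I : set (measurableTypeR R)) (fun t => f t - F n t).
  by apply: cmeasB => //; case: (dF n) => -[].
have [n ne] := nrm_cvg0 mI mFn ig Fg F0 e0.
by exists (F n).
Qed.

(** This is sin^2 (pi (t - a) / T), normalised to the range [0, 1] that [threshold] requires and
    smallest at the centre a. *)
Definition wave (a t : R) : R := (1 - cos (2 * pi * ((t - a) / T))) / 2.

Lemma wave01 a t : 0 <= wave a t <= 1.
Proof.
rewrite /wave; have := cos_geN1 (2 * pi * ((t - a) / T)).
have := cos_le1 (2 * pi * ((t - a) / T)); lra.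
Qed.

Lemma trigpoly_wave a : trigpoly (fun t => (wave a t)%:C).
Proof.
have h : trigpoly (fun t => (2^-1)%:C + ((- 4^-1)%:C * ee (- a / T) * en T 1 t +
    (- 4^-1)%:C * ee (a / T) * en T (-1) t)).
  apply: trigpolyD; first exact: trigpoly_cst.
  by apply: trigpolyD; (apply: trigpolyM; [exact: trigpoly_cst|exact: trigpoly_en]).
apply: eq_trigpoly h => t.
rewrite -!mulrA /en -!eeD.
have -> : - a / T + t * (1%:~R / T) = (t - a) / T by rewrite mulr1z; ring.
have -> : a / T + t * ((-1)%:~R / T) = - ((t - a) / T) by rewrite mulrN1z; ring.
rewrite -eeJ; apply: complexP; rewrite !ReImE ReEe ?ImEe /wave/=; by field.
Qed.

(* Thus the superlevel sets of a cosine, i.e. arcs of the circle, have indicator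
   functions which are bounded pointwise limits of trigonometric polynomials. *)
Lemma trigpoly_threshold k n a : trigpoly (fun t => (threshold k n (wave a t))%:C).
Proof.
have h : trigpoly (fun t => (1 + -1 * (wave a t)%:C ^+ n) ^+ Num.truncn (n.+1%:R / k ^+ n)).
  apply: trigpolyX; apply: trigpolyD; first exact: trigpoly_cst.
  apply: trigpolyM; first exact: trigpoly_cst.
  by apply: trigpolyX; exact: trigpoly_wave.
apply: eq_trigpoly h => t.
by rewrite mulN1r /threshold rmorphXn rmorphB rmorphXn rmorph1.
Qed.

End trigonometric_density.

(** * Indicators of arcs and rays *)

Section parseval_identity.
Context {R : realType}.
Notation mu := (@lebesgue_measure R).
Variables (c T : R).
Hypothesis T0 : 0 < T.
Notation I := (`]c, c + T[%classic : set R).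

Let mI : measurable (I : set (measurableTypeR R)). Proof. exact: measurable_itv. Qed.

Lemma in_setb (p : R -> bool) t : (t \in ([set t | p t] : set R)) = p t.
Proof. by apply/idP/idP => [/set_mem|tp]; [|exact: mem_set]. Qed.

Lemma L2on_indic (A : set (measurableTypeR R)) : measurable A ->
  L2on mu I (fun t => (\1_A t)%:C).
Proof.
move=> mA; apply: (@L2on_bounded _ _ _ mu I mI _ 1 (finite_period c T0)).
  by split; [exact: measurable_indic|exact: measurable_cst].
by move=> t _; rewrite normsqC indicE; case: (_ \in _); rewrite ?expr0n ?expr1n//= ler01.
Qed.

Lemma continuous_wave a : continuous (@wave R T a).
Proof.
have h (x : R) : is_derive x 1 (fun t => cos (2 * pi * ((t - a) / T)))
    (- sin (2 * pi * ((x - a) / T)) * (2 * pi / T)).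
  have d1 : is_derive x 1 (fun t => 2 * pi * ((t - a) / T)) (2 * pi / T).
    have -> : (fun t => 2 * pi * ((t - a) / T)) =
        (fun t => (2 * pi / T) * t) \+ cst (- (2 * pi / T * a)).
      by apply/funext => t /=; ring.
    by have := is_deriveD (is_derive_mull (2 * pi / T) x)
      (is_derive_cst (- (2 * pi / T * a)) x 1); rewrite addr0.
  exact: (is_derive1_comp (is_derive_cos _) d1).
have hc := is_derive_continuous h.
move=> x; rewrite /wave; apply: cvgMr_tmp; apply: cvgB; first exact: cvg_cst.
exact: hc.
Qed.

Lemma measurable_wave_lt k a :
  measurable ([set t | wave T a t < k] : set (measurableTypeR R)).
Proof.
have m := continuous_measurable_fun (@continuous_wave a).
have -> : [set t | wave T a t < k] = setT `&` wave T a @^-1` `]-oo, k[%classic.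
  by rewrite setTI; apply/seteqP; split=> t /=; rewrite in_itv/=.
by apply: m => //; exact: measurable_itv.
Qed.

Lemma trig_dense_wave k a : 0 < k ->
  trig_dense c T (fun t => (\1_[set t | wave T a t < k] t)%:C).
Proof.
move=> k0; apply: (@trig_dense_cvg _ c T T0 (fun n t => (threshold k n (wave T a t))%:C) _ (fun=> 1)).
- by move=> n; apply: trig_dense_trigpoly => //; exact: trigpoly_threshold.
- by case: (L2on_indic (measurable_wave_lt k a)).
- exact: (@integrable_cst _ _ _ mu I mI 1 (finite_period c T0)).
- move=> n t _; rewrite -rmorphB normsqC -real_normK ?num_real// expr_le1// ler_norml.
  have := threshold_ge0 k n (wave01 T a t); have := threshold_le1 k n (wave01 T a t).
  by rewrite indicE; case: (_ \in _) => /=; lra.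
- exact: L2on_indic (measurable_wave_lt k a).
- move=> t _.
  have h : (fun n => threshold k n (wave T a t)) @ \oo --> (\1_[set t | wave T a t < k] t : R).
    by rewrite indicE in_setb; exact: threshold_cvg k0 (wave01 T a t).
  set l := \1__ t in h *.
  have -> : (fun n => normsq (l%:C - (threshold k n (wave T a t))%:C)) =
      (fun n => (l - threshold k n (wave T a t)) * (l - threshold k n (wave T a t))).
    by apply/funext => n; rewrite -rmorphB normsqC expr2.
  have h2 : (fun n => l - threshold k n (wave T a t)) @ \oo --> 0.
    by rewrite -(subrr l); apply: cvgB => //; exact: cvg_cst.
  by rewrite -[X in _ --> X](mulr0 0); exact: (cvgM h2 h2).
Qed.

(** The arc centred at the midpoint of c and b ends at c and b, so within the open period that
    starts at c it consists of the points before b. *)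
Lemma wave_lt b t : c < b -> b < c + T -> c < t -> t < c + T ->
  (wave T ((c + b) / 2) t < wave T ((c + b) / 2) b) = (t < b).
Proof.
move=> cb bT ct tT; rewrite /wave ltr_pM2r// ltrD2l ltrN2.
set a := (c + b) / 2; set x := (t - a) / T; set y := (b - a) / T.
have hy : b = a + y * T by rewrite /y divfK ?gt_eqF//; ring.
have hx : t = a + x * T by rewrite /x divfK ?gt_eqF//; ring.
have hc : c = a - y * T by rewrite -(subrK b c) {2}hy /a; move: hy; rewrite /a; lra.
have y0 : 0 < y by rewrite -(pmulr_lgt0 _ T0); lra.
have y1 : y < 2^-1 by rewrite -(ltr_pM2r T0); lra.
have xy : - y < x by rewrite -(ltr_pM2r T0); lra.
have x1 : x < 1 - y by rewrite -(ltr_pM2r T0); lra.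
have -> : (t < b) = (x < y) by rewrite hx hy ltrD2l ltr_pM2r.
have pi0 := pi_gt0 R.
have itv (z : R) : 0 <= z -> z <= 2^-1 -> 2 * pi * z \in `[0, (pi : R)].
  move=> z0 z1; rewrite in_itv/= !mulr_ge0 ?pi_ge0//=.
  have z2 : 0 <= 2^-1 - z by rewrite subr_ge0.
  by have := mulr_ge0 (ltW pi0) z2; lra.
have mono (z : R) : 0 <= z -> z <= 2^-1 -> (cos (2 * pi * y) < cos (2 * pi * z)) = (z < y).
  move=> z0 z1; rewrite ltr_cos ?itv ?(ltW y0) ?(ltW y1)//.
  by rewrite ltr_pM2l// mulr_gt0.
(* Evenness sends x < 0 to - x, and periodicity sends x > 1 / 2 to 1 - x. Both land in [0, 1 / 2],
   where the cosine is monotone. *)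
have [x0|x0] := leP 0 x; last first.
  rewrite -(cosN (2 * pi * x)) -mulrN mono; [|lra..].
  by apply/idP/idP => _; lra.
have [x2|x2] := leP x 2^-1; first by rewrite mono.
have -> : cos (2 * pi * x) = cos (2 * pi * (1 - x)).
  rewrite mulrBr mulr1 mulr_natl cosB cos2pi sin2pi; ring.
rewrite mono; [|lra..].
by apply/idP/idP => ?; lra.
Qed.

(** Within one period a ray is empty, everything, or an arc. Rays are chosen because they are stable
    under intersection and generate the Borel sets. *)
Lemma trig_dense_ray b : trig_dense c T (fun t => (\1_(`]-oo, b[%classic : set R) t)%:C).
Proof.
have indE t : \1_(`]-oo, b[%classic : set R) t = (t < b)%R%:R :> R.
  by rewrite indicE mem_setE/= in_itv.
have [bc|cb] := leP b c.
  apply: eq_trig_dense (trig_dense0 c T0) => t /=; rewrite in_itv/= => /andP[ct _].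
  by rewrite indE ltNge (le_trans bc (ltW ct)).
have [bT|bT] := leP (c + T) b.
  apply: eq_trig_dense (trig_dense_trigpoly c T0 (trigpoly_cst T 1)) => t /=.
  by rewrite in_itv/= => /andP[_ tT]; rewrite indE (lt_le_trans tT bT).
have k0 : 0 < wave T ((c + b) / 2) b.
  have := wave_lt cb bT (t := (c + b) / 2).
  have -> : (c + b) / 2 < b by lra.
  move=> h; have {h} := h ltac:(lra) ltac:(lra).
  by apply: le_lt_trans; case/andP: (wave01 T ((c + b) / 2) ((c + b) / 2)).
apply: eq_trig_dense (trig_dense_wave ((c + b) / 2) k0) => t /=.
rewrite in_itv/= => /andP[ct tT]; rewrite indE; congr (_%:C).
by rewrite indicE in_setb wave_lt.
Qed.

End parseval_identity.

Import HBNNSimple.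

(** * From indicators to all of L^2, and Parseval's identity *)

Section parseval_equality.
Context {R : realType}.
Notation mu := (@lebesgue_measure R).
Variables (c T : R).
Hypothesis T0 : 0 < T.
Notation I := (`]c, c + T[%classic : set R).

Let mI : measurable (I : set (measurableTypeR R)). Proof. exact: measurable_itv. Qed.

(** Dynkin's lemma: the measurable sets whose indicator lies in the closure form a lambda-system
    that contains the rays. Linearity handles differences, dominated convergence increasing
    unions. *)
Lemma trig_dense_indic (A : set (measurableTypeR R)) : measurable A ->
  trig_dense c T (fun t => (\1_A t)%:C).
Proof.
pose H : set (set R) := [set B : set R | measurable (B : set (measurableTypeR R)) /\
  trig_dense c T (fun t => (\1_B t)%:C)].
suff : (R.-ocitv.-measurable).-sigma.-measurable `<=` H by move=> h /h[].
rewrite RGenInftyO.measurableE; apply: lambda_system_subset => //.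
- move=> _ _ [x ->] [y ->]; exists (Num.min x y); apply/seteqP; split => z /=;
  by rewrite !in_itv/= lt_min => /andP.
- split.
  + by [].
  + split; first exact: measurableT.
    apply: eq_trig_dense (trig_dense_trigpoly c T0 (trigpoly_cst T 1)) => t _.
    by rewrite indicT.
  + move=> A' B BA [mA dA] [mB dB]; split; first exact: measurableD.
    apply: eq_trig_dense (trig_denseB T0 dA dB) => t _; rewrite -rmorphB; congr (_%:C).
    rewrite !indicE in_setD; have [tB|tB] := boolP (t \in B); last by rewrite subr0 andbT.
    have -> : t \in A' by apply: mem_set; apply: BA; exact: set_mem tB.
    by rewrite subrr.
  + move=> F ndF HF; have mF : measurable (\bigcup_i F i : set (measurableTypeR R)).
      by apply: bigcupT_measurable => i; case: (HF i).
    split => //.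
    have iF := L2on_indic c T0 mF.
    apply: (@trig_dense_cvg _ c T T0 (fun n t => (\1_(F n) t)%:C) _ (fun=> 1)).
    * by move=> n; case: (HF n).
    * by case: iF.
    * exact: (@integrable_cst _ _ _ mu I mI 1 (finite_period c T0)).
    * move=> n t _; rewrite -rmorphB normsqC !indicE.
      by do 2! case: (_ \in _); rewrite ?(subrr, subr0, sub0r, sqrrN, expr1n, expr0n)/= ?ler01.
    * exact: iF.
    * move=> t _; apply: cvg_near_cst.
      have [tF|tF] := boolP (t \in \bigcup_i F i).
        case: (set_mem tF) => N _ FN; exists N => // n /= Nn.
        rewrite !indicE tF; have -> : t \in F n.
          by apply: mem_set; move: (ndF _ _ Nn) => /subsetPset; apply.
        by rewrite subrr normsq0.
      exists 0%N => // n _ /=; rewrite !indicE (negPf tF); have -> : t \in F n = false.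
        by apply/negbTE; apply: contra tF => /set_mem h; apply: mem_set; exists n.
      by rewrite subrr normsq0.
- move=> _ [x ->]; split; first exact: measurable_itv.
  exact: trig_dense_ray.
Qed.

(** Simple functions F_n increase to h from below, so |h - F_n|^2 is dominated by h^2. *)
Lemma trig_dense_ge0 (h : R -> R) :
  measurable_fun (I : set (measurableTypeR R)) h -> (forall t, I t -> 0 <= h t) ->
  L2on mu I (fun t => (h t)%:C) -> trig_dense c T (fun t => (h t)%:C).
Proof.
move=> mh h0 hi.
have mh' : measurable_fun (I : set (measurableTypeR R)) (EFin \o h) by exact/measurable_EFinP.
have h0' x : I x -> (0%R <= (EFin \o h) x)%E by move=> ?; rewrite lee_fin h0.
pose F n t := nnsfun_approx mI mh' n t.
apply: (@trig_dense_cvg _ c T T0 (fun n t => (F n t)%:C) _ (fun t => h t ^+ 2)).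
- move=> n.
  apply: (@eq_trig_dense _ c T (fun t => \sum_(i < #|` fset_set (range (nnsfun_approx mI mh' n))|)
    ((fset_set (range (nnsfun_approx mI mh' n)))`_i)%:C *
    (\1_(nnsfun_approx mI mh' n @^-1` [set (fset_set (range (nnsfun_approx mI mh' n)))`_i]) t)%:C)).
    move=> t _; rewrite /F [in RHS]fimfunEord rmorph_sum/=; apply: eq_bigr => i _.
    by rewrite rmorphM.
  apply: trig_dense_sum => // i; apply: trig_denseZ => //.
  apply: trig_dense_indic; exact: measurable_funPTI.
- by case: hi.
- case: hi => _; apply: eq_integrable => // t _ /=; by rewrite normsqC.
- move=> n t It; rewrite -rmorphB normsqC ler_sqr ?nnegrE ?subr_ge0 ?h0//.
  + by rewrite lerBlDr lerDl; exact: fun_ge0.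
  + by have := le_approx n h0' It; rewrite /F nnsfun_approxE lee_fin.
- exact: hi.
- move=> t It.
  have h1 : (fun n => F n t) @ \oo --> h t.
    by have := cvg_nnsfun_approx mI mh' h0' It; move/fine_cvg.
  have -> : (fun n => normsq ((h t)%:C - (F n t)%:C)) =
      (fun n => (h t - F n t) * (h t - F n t)).
    by apply/funext => n; rewrite -rmorphB normsqC expr2.
  have h2 : (fun n => h t - F n t) @ \oo --> 0.
    by rewrite -(subrr (h t)); apply: cvgB => //; exact: cvg_cst.
  by rewrite -[X in _ --> X](mulr0 0); exact: (cvgM h2 h2).
Qed.

Lemma trig_dense_real (h : R -> R) :
  measurable_fun (I : set (measurableTypeR R)) h ->
  L2on mu I (fun t => (h t)%:C) -> trig_dense c T (fun t => (h t)%:C).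
Proof.
move=> mh hi.
have mn : measurable_fun (I : set (measurableTypeR R)) (fun t => `|h t|).
  exact: measurableT_comp.
have mC (k : R -> R) : measurable_fun (I : set (measurableTypeR R)) k ->
    cmeas (I : set (measurableTypeR R)) (fun t => (k t)%:C).
  by move=> mk; split => //; exact: measurable_cst.
have ni : L2on mu I (fun t => (`|h t|)%:C).
  split; first exact: mC.
  by case: hi => _; apply: eq_integrable => // t _; rewrite !normsqC real_normK ?num_real.
(* The decomposition h = |h| - (|h| - h) has two nonnegative terms. *)
have := trig_denseB T0 (@trig_dense_ge0 (fun t => `|h t|) mn _ ni)
  (@trig_dense_ge0 (fun t => `|h t| - h t) _ _ _).
move=> H; apply: eq_trig_dense (H _ _ _ _).
- by move=> t _; rewrite -rmorphB subKr.
- by move=> t _; exact: normr_ge0.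
- exact: measurable_funB.
- by move=> t _; rewrite subr_ge0 ler_norm.
- by apply: (eq_L2on mI _ (L2onB mI ni hi)) => t _; rewrite -rmorphB.
Qed.

Lemma trig_dense_L2 f : L2on mu I f -> trig_dense c T f.
Proof.
move=> [[mR mJ] fi].
have h1 : L2on mu I (fun t => (complex.Re (f t))%:C).
  apply: (@L2on_le _ _ _ mu I mI _ (fun t => normsq (f t))) => //.
  by move=> t _; rewrite normsqC /normsq lerDl sqr_ge0.
have h2 : L2on mu I (fun t => (complex.Im (f t))%:C).
  apply: (@L2on_le _ _ _ mu I mI _ (fun t => normsq (f t))) => //.
  by move=> t _; rewrite normsqC /normsq lerDr sqr_ge0.
apply: eq_trig_dense (trig_denseD T0 (trig_dense_real mR h1)
  (trig_denseZ T0 'i%C (trig_dense_real mJ h2))) => t _.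
by apply: complexP; rewrite !ReImE/=; ring.
Qed.

(** One inequality is Bessel on each finite set of frequencies. For the other, the finite set
    consists of the frequencies of an approximating polynomial. Its error is taken to be e / T
    because [bessel_approx] is then multiplied by T. *)
Lemma parseval f : L2on mu I f ->
  (\esum_(n in [set: int]) (normsq (coef c T f n))%:E = (T * nrm mu I f)%:E)%E.
Proof.
move=> fi; apply/eqP; rewrite eq_le; apply/andP; split.
  apply: ge_ereal_sup => _ [A [finA _] <-]; rewrite fsbig_finite//=.
  by rewrite sumEFin lee_fin; apply: bessel => //; exact: fset_uniq.
apply/lee_addgt0Pr => e e0.
have [_ /(_ _ (divr_gt0 e0 T0)) [p [tp pe]]] := trig_dense_L2 fi.
have [s [a [us pE]]] := trigpoly_uniq tp.
have := bessel_approx T0 a fi us.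
rewrite (@eq_nrm _ _ _ mu I (fun t => f t - \sum_(m <- s) a m * en T m t)
  (fun t => f t - p t)); last by move=> t _; rewrite pE.
set S := \sum_(m <- s) _.
move=> /le_trans /(_ pe); rewrite lerBlDr => /(ler_wpM2l (ltW T0)).
have -> : T * (e / T + T^-1 * S) = e + S by field; rewrite gt_eqF.
move=> h.
apply: (@le_trans _ _ (e%:E + S%:E)%E).
  by rewrite -EFinD lee_fin.
rewrite addeC leeD2r//; apply: esum_ge; exists [set` s].
  by split => //; exact: finite_seq.
by rewrite -sumEFin -fsbig_seq.
Qed.

End parseval_equality.

(** * Translations and tilings of the line *)

Section integer_series.
Context d {T : measurableType d} {R : realType}.
Variable mu : {measure set T -> \bar R}.
Local Open Scope ereal_scope.

(** Turns an unordered sum over the integers into a series over [nat], to which the theorems on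
    measurability and term-by-term integration apply. *)
Lemma int_nat_bij : exists e : nat -> int, set_bij [set: nat] [set: int] e.
Proof.
exists (fun n => if odd n then Negz n./2 else Posz n./2); split => //.
  move=> m n _ _ h; rewrite -(odd_double_half m) -(odd_double_half n).
  by move: h; case: (odd m); case: (odd n) => // -[->].
move=> [k|k] _ /=; first by exists k.*2 => //; rewrite odd_double doubleK.
by exists k.*2.+1 => //=; rewrite odd_double /= uphalf_double.
Qed.

Variables (D : set T) (f : int -> T -> \bar R).
Hypothesis mD : measurable D.
Hypothesis mf : forall n, measurable_fun D (f n).
Hypothesis f0 : forall n x, 0 <= f n x.

Lemma emeasurable_esum_int : measurable_fun D (fun x => \esum_(n in [set: int]) f n x).
Proof.
have [e be] := int_nat_bij.
have -> : (fun x => \esum_(n in [set: int]) f n x) = (fun x => \sum_(i <oo) f (e i) x).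
  by apply/funext => x; rewrite (reindex_esum [set: nat] [set: int] e)// nneseries_esumT.
by apply: ge0_emeasurable_sum => [k x _ _|k _]; [exact: f0|exact: mf].
Qed.

Lemma integral_esum_int : \int[mu]_(x in D) (\esum_(n in [set: int]) f n x) =
  \esum_(n in [set: int]) \int[mu]_(x in D) f n x.
Proof.
have [e be] := int_nat_bij.
rewrite (reindex_esum [set: nat] [set: int] e)//.
have h n : 0 <= \int[mu]_(x in D) f (e n) x by apply: integral_ge0.
rewrite -(nneseries_esumT h) -integral_nneseries//.
apply: eq_integral => x _.
by rewrite (reindex_esum [set: nat] [set: int] e)// nneseries_esumT.
Qed.
End integer_series.

Section translation.
Context {R : realType}.
Notation mu := (@lebesgue_measure R).
Local Open Scope ereal_scope.
Implicit Types (a b t : R).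

Lemma measurable_shift t :
  measurable_fun setT ((fun x : R => x + t)%R : measurableTypeR R -> measurableTypeR R).
Proof.
by apply: continuous_measurable_fun => x; apply: cvgD; [exact: cvg_id|exact: cvg_cst].
Qed.

Lemma shift_preimage_itv t (b0 b1 : bool) a b :
  (fun x : R => x + t)%R @^-1` [set` Interval (BSide b0 a) (BSide b1 b)] =
  [set` Interval (BSide b0 (a - t)%R) (BSide b1 (b - t)%R)].
Proof.
by apply/seteqP; split => x; case: b0; case: b1;
  rewrite /= !in_itv/= ?lerBlDr ?lerBrDr ?ltrBlDr ?ltrBrDr.
Qed.

(** By uniqueness of Lebesgue measure it suffices to compare the two measures on half-open
    intervals. *)
Lemma lebesgue_measure_shift t (A : set (measurableTypeR R)) : measurable A ->
  pushforward mu ((fun x : R => x + t)%R : measurableTypeR R -> measurableTypeR R) A = mu A.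
Proof.
pose m : {mfun measurableTypeR R >-> measurableTypeR R} :=
  HB.pack ((fun x : R => x + t)%R : measurableTypeR R -> measurableTypeR R)
    (isMeasurableFun.Build _ _ _ _ _ (measurable_shift t)).
move=> mA; apply/esym.
apply: (@lebesgue_measure_unique R (pushforward mu m)) => //= _ [[a b]] _ <-.
rewrite /pushforward (shift_preimage_itv t false false) !lebesgue_measure_itv/=.
rewrite !lte_fin ltrD2r; case: ifP => // _.
by rewrite -!EFinD; congr EFin; ring.
Qed.

Lemma ge0_integral_shift t (D : set (measurableTypeR R)) (f : R -> \bar R) :
  measurable D -> measurable_fun (setT : set (measurableTypeR R)) f -> (forall x, 0 <= f x) ->
  \int[mu]_(x in (fun x : R => x + t)%R @^-1` D) (f (x + t)%R) = \int[mu]_(x in D) f x.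
Proof.
move=> mD mf f0.
have mt := measurable_shift t.
transitivity (\int[pushforward mu ((fun x : R => x + t)%R : measurableTypeR R -> measurableTypeR R)]_(x in D) f x).
  apply/esym; apply: (ge0_integral_pushforward mt mu) => //.
  exact: measurable_funS mf.
by apply: eq_measure_integral => A mA _; exact: lebesgue_measure_shift.
Qed.

Lemma ge0_integral_shiftT t (f : R -> \bar R) :
  measurable_fun (setT : set (measurableTypeR R)) f -> (forall x, 0 <= f x) ->
  \int[mu]_x (f (x + t)%R) = \int[mu]_x f x.
Proof. by move=> mf f0; rewrite -[RHS](ge0_integral_shift t)// preimage_setT. Qed.

(** Half-open tiles partition the line: x lies only in the tile of index floor ((x - a) / s). The
    function is the sum of its restrictions to the tiles, and each is translated back to the first
    one. *)
Lemma ge0_integral_tile (a s : R) (f : R -> \bar R) : (0 < s)%R ->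
  measurable_fun (setT : set (measurableTypeR R)) f -> (forall x, 0 <= f x) ->
  \int[mu]_x f x =
  \int[mu]_(x in `[a, (a + s)%R[) (\esum_(n in [set: int]) f (x + n%:~R * s)%R).
Proof.
move=> s0 mf f0.
pose J (n : int) : set (measurableTypeR R) := `[(a + n%:~R * s)%R, (a + (n + 1)%:~R * s)%R[%classic.
have mJ n : measurable (J n) by exact: measurable_itv.
have JE n x : J n x <-> n = Num.floor ((x - a) / s).
  rewrite /J/= in_itv/= -lerBrDl -ltrBlDl -ler_pdivlMr// -ltr_pdivrMr//.
  split=> [h|->]; last exact: floor_itv.
  by apply/esym/floor_def; rewrite h.
rewrite integral_esum_int//; last by move=> n; apply: measurableT_comp => //; exact: measurable_funTS (measurable_shift _).
have -> : (fun x => f x) = (fun x => \esum_(n in [set: int]) (f \_ (J n)) x).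
  apply/funext => x; rewrite -(@esum_set1 _ _ (Num.floor ((x - a) / s)) (fun=> f x))//.
  rewrite esum_mkcond; apply: eq_esum => n _; rewrite patchE.
  have [/set_mem/= ->|nn] := boolP (n \in [set Num.floor ((x - a) / s)]).
    by rewrite mem_set//; exact/JE.
  by rewrite memNset// => /JE nE; move: nn; rewrite nE mem_set.
rewrite integral_esum_int//; last 2 first.
- by move=> n; apply/(measurable_restrictT _ (mJ n)); exact: measurable_funS mf.
- by move=> n x; rewrite patchE; case: ifP.
apply: eq_esum => n _; rewrite -integral_mkcond -(ge0_integral_shift (n%:~R * s))//.
rewrite shift_preimage_itv; congr (\int[mu]_(x in [set` Interval (BSide true _) (BSide true _)]) _).
- by apply/funext => _; ring.
- by apply/funext => _; rewrite rmorphD/=; ring.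
Qed.

End translation.

(** * The Fourier transform *)

Section fubini_complex.
Context {R : realType}.
Notation mu := (@lebesgue_measure R).
Notation RR := (measurableTypeR R).

Lemma integrable_prod (h k : R -> R) :
  (forall x, 0 <= h x) -> (forall x, 0 <= k x) ->
  mu.-integrable (setT : set RR) (EFin \o h) -> mu.-integrable (setT : set RR) (EFin \o k) ->
  (mu \x mu)%E.-integrable setT (EFin \o (fun z : RR * RR => h z.1 * k z.2)).
Proof.
move=> h0 k0 ih ik.
have mh : measurable_fun (setT : set RR) h by case/integrableP: ih => /measurable_EFinP.
have mk : measurable_fun (setT : set RR) k by case/integrableP: ik => /measurable_EFinP.
apply/integrable12ltyP.
  apply/measurable_EFinP; apply: measurable_funM; first exact: measurableT_comp.
  exact: measurableT_comp.
have -> : (\int[mu]_x \int[mu]_y `|(EFin \o (fun z : RR * RR => (h z.1 * k z.2)%R)) (x, y)| =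
    \int[mu]_x ((\int[mu]_y (k y)%:E) * (h x)%:E))%E.
  apply: eq_integral => x _; rewrite muleC -ge0_integralZl_EFin//; [|by move=> y _; rewrite lee_fin|exact/measurable_EFinP].
  by apply: eq_integral => y _ /=; rewrite ger0_norm ?mulr_ge0// EFinM.
have k1 : (0 <= \int[mu]_y (k y)%:E)%E by apply: integral_ge0 => y _; rewrite lee_fin.
have mhE : measurable_fun (setT : set RR) (fun x => (h x)%:E) by exact/measurable_EFinP.
set C := (\int[mu]_y (k y)%:E)%E in k1 *.
have E : (\int[mu]_x (C * (h x)%:E) = C * \int[mu]_x (h x)%:E)%E.
  by apply: (@ge0_integralZl _ _ _ mu setT measurableT (fun x => (h x)%:E) mhE) => // ? _; rewrite lee_fin.
apply: (@le_lt_trans _ _ (C * \int[mu]_x (h x)%:E)%E); first by rewrite -E.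
have [_ kf] := integrableP _ _ _ ik; have [_ hf] := integrableP _ _ _ ih.
have E1 (g : R -> R) : (forall x, 0 <= g x) ->
    (\int[mu]_x (g x)%:E = \int[mu]_x `|(EFin \o g) x|)%E.
  by move=> g0; apply: eq_integral => y _ /=; rewrite ger0_norm.
by apply: lte_mul_pinfty => //; [rewrite ge0_fin_numE// /C E1|rewrite E1].
Qed.

(** The majorant h x * k y provides the integrability on the plane that Fubini requires. *)
Lemma Rintegral_exchange (f : RR * RR -> R) (h k : R -> R) :
  measurable_fun setT f ->
  (forall x, 0 <= h x) -> (forall x, 0 <= k x) ->
  mu.-integrable (setT : set RR) (EFin \o h) -> mu.-integrable (setT : set RR) (EFin \o k) ->
  (forall x y, `|f (x, y)| <= h x * k y) ->
  Rintegral mu setT (fun x => Rintegral mu setT (fun y => f (x, y))) =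
  Rintegral mu setT (fun y => Rintegral mu setT (fun x => f (x, y))).
Proof.
move=> mf h0 k0 ih ik fhk.
have iP : (mu \x mu)%E.-integrable setT (EFin \o f).
  apply: le_integrable (integrable_prod h0 k0 ih ik) => //; first exact/measurable_EFinP.
  by move=> [x y] _; rewrite lee_fin/= (ger0_norm (mulr_ge0 _ _)).
have i1 x : mu.-integrable (setT : set RR) (fun y => (f (x, y))%:E).
  apply: (le_integrable _ _ _ (integrableZl _ (h x) ik)) => //.
    by apply/measurable_EFinP; exact: measurableT_comp.
  by move=> y _; rewrite lee_fin/= (ger0_norm (mulr_ge0 _ _)).
have i2 y : mu.-integrable (setT : set RR) (fun x => (f (x, y))%:E).
  apply: (le_integrable _ _ _ (integrableZl _ (k y) ih)) => //.
    by apply/measurable_EFinP; exact: measurableT_comp.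
  by move=> x _; rewrite lee_fin/= (ger0_norm (mulr_ge0 _ _))// mulrC.
rewrite /Rintegral; congr fine.
transitivity (\int[mu]_x \int[mu]_y (f (x, y))%:E)%E.
  by apply: eq_integral => x _; rewrite fineK//; exact: integrable_fin_num.
rewrite [LHS](Fubini iP).
by apply: eq_integral => y _; rewrite fineK//; exact: integrable_fin_num.
Qed.

Lemma cint_exchange (f : RR * RR -> R[i]) (h k : R -> R) :
  cmeas setT f ->
  (forall x, 0 <= h x) -> (forall x, 0 <= k x) ->
  mu.-integrable (setT : set RR) (EFin \o h) -> mu.-integrable (setT : set RR) (EFin \o k) ->
  (forall x y, `|complex.Re (f (x, y))| <= h x * k y) ->
  (forall x y, `|complex.Im (f (x, y))| <= h x * k y) ->
  cint mu setT (fun x => cint mu setT (fun y => f (x, y))) =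
  cint mu setT (fun y => cint mu setT (fun x => f (x, y))).
Proof.
move=> [mR mI] h0 k0 ih ik fR fI; apply: complexP.
- exact: (Rintegral_exchange mR h0 k0 ih ik fR).
- exact: (Rintegral_exchange mI h0 k0 ih ik fI).
Qed.

End fubini_complex.

Section fourier.
Context {R : realType}.
Notation mu := (@lebesgue_measure R).
Notation RR := (measurableTypeR R).

Definition fourier (f : R -> R[i]) (x : R) : R[i] :=
  cint mu setT (fun t => f t * ee (t * - x)).

Lemma cintegrable_ee D f y : measurable (D : set RR) -> cintegrable mu D f ->
  cintegrable mu D (fun t => f t * ee (t * y)).
Proof.
move=> mD fi; apply: cintegrableM_bounded => //; first exact: cmeas_ee.
by exists 1 => t _; rewrite normsq_ee.
Qed.

Lemma fourier_modulation f y x :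
  fourier (fun t => f t * ee (t * - y)) x = fourier f (x + y).
Proof.
apply: eq_cint => t _; rewrite -mulrA -eeD; congr (_ * ee _); ring.
Qed.

(** The norm |Re| + |Im| is submultiplicative. This gives a majorant in which the two variables
    separate, as the exchange of integrals demands. *)
Lemma bound_normM_ee (z : R[i]) (w : R[i]) x :
  `|complex.Re (z * w * ee x)| <= (`|complex.Re z| + `|complex.Im z|) *
    (`|complex.Re w| + `|complex.Im w|) /\
  `|complex.Im (z * w * ee x)| <= (`|complex.Re z| + `|complex.Im z|) *
    (`|complex.Re w| + `|complex.Im w|).
Proof.
have cs := cos_max (2 * pi * x); have sn := sin_max (2 * pi * x).
have key (p q c s : R) : `|c| <= 1 -> `|s| <= 1 -> `|p * c| + `|q * s| <= `|p| + `|q|.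
  by move=> c1 s1; rewrite !normrM lerD// ler_piMr.
have pq : `|complex.Re (z * w)| + `|complex.Im (z * w)| <=
    (`|complex.Re z| + `|complex.Im z|) * (`|complex.Re w| + `|complex.Im w|).
  rewrite !ReImE; apply: (le_trans (lerD (ler_normB _ _) (ler_normD _ _))).
  by rewrite !normrM; lra.
rewrite cReM cImM ReEe ImEe; split.
- exact: le_trans (ler_normB _ _) (le_trans (key _ _ _ _ cs sn) pq).
- apply: le_trans (ler_normD _ _) _; apply: le_trans (key _ _ _ _ sn cs) pq.
Qed.

(** Measurability comes from continuity, obtained under the integral sign with the majorant |Re f| +
    |Im f|, which does not depend on x. *)
Lemma cmeas_fourier f : cintegrable mu setT f -> cmeas (setT : set RR) (fourier f).
Proof.
move=> fi.
have bnd t x : `|complex.Re (f t * ee (t * - x))| <= `|complex.Re (f t)| + `|complex.Im (f t)| /\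
    `|complex.Im (f t * ee (t * - x))| <= `|complex.Re (f t)| + `|complex.Im (f t)|.
  by have := bound_normM_ee (f t) 1 (t * - x); rewrite mulr1 cRe1 cIm1 normr1 normr0 addr0 mulr1.
have ii x := cintegrable_ee (- x) (@measurableT _ RR) fi.
have cc (t : R) : continuous (fun x : R => cos (2 * pi * (t * - x))).
  move=> x; apply: continuous_comp; last exact: continuous_cos.
  by apply: cvgMl_tmp; apply: cvgMl_tmp; apply: cvgN; exact: cvg_id.
have cs (t : R) : continuous (fun x : R => sin (2 * pi * (t * - x))).
  move=> x; apply: continuous_comp; last exact: continuous_sin.
  by apply: cvgMl_tmp; apply: cvgMl_tmp; apply: cvgN; exact: cvg_id.
have key (F : R -> R -> R) : (forall x, mu.-integrable (setT : set RR) (EFin \o F x)) ->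
    (forall t, continuous (F ^~ t)) ->
    (forall x t, `|F x t| <= `|complex.Re (f t)| + `|complex.Im (f t)|) ->
    continuous (fun x => Rintegral mu setT (F x)).
  move=> iF cF bF x.
  have xI : x \in (`]x - 1, x + 1[%classic : set R).
    by rewrite mem_setE/= in_itv/= ltrDl ltrBlDr ltrDl ltr01.
  apply: (@continuity_under_integral R _ RR mu F setT _ (x - 1) (x + 1) _ _
    (fun t => `|complex.Re (f t)| + `|complex.Im (f t)|)) => //.
  - by apply: aeW => t _ y _; exact: cF.
  - exact: cintegrable_norm1.
  - by move=> y _; apply: aeW => t _; exact: bF.
split; apply: continuous_measurable_fun.
- apply: (key (fun x t => complex.Re (f t * ee (t * - x)))).
  + by move=> x; case: (ii x).
  + move=> t x; under eq_fun do rewrite cReM ReEe ImEe.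
    by apply: cvgB; apply: cvgMl_tmp; [exact: cc|exact: cs].
  + by move=> x t; case: (bnd t x).
- apply: (key (fun x t => complex.Im (f t * ee (t * - x)))).
  + by move=> x; case: (ii x).
  + move=> t x; under eq_fun do rewrite cImM ReEe ImEe.
    by apply: cvgD; apply: cvgMl_tmp; [exact: cs|exact: cc].
  + by move=> x t; case: (bnd t x).
Qed.

(** The kernel f(t) g(x) e(- t x) is integrated in the two possible orders. *)
Lemma fourier_mult f g : cintegrable mu setT f -> cintegrable mu setT g ->
  cint mu setT (fun t => f t * fourier g t) = cint mu setT (fun x => fourier f x * g x).
Proof.
move=> fi gi.
pose K (z : RR * RR) := f z.1 * g z.2 * ee (z.1 * - z.2).
have mT : measurable (setT : set RR) by exact: measurableT.
transitivity (cint mu setT (fun t => cint mu setT (fun x => K (t, x)))).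
  apply: eq_cint => t _; rewrite -cintZ//; last exact: cintegrable_ee.
  by apply: eq_cint => x _; rewrite /K/= mulrA; congr (_ * ee _); ring.
transitivity (cint mu setT (fun x => cint mu setT (fun t => K (t, x)))); last first.
  apply: eq_cint => x _; rewrite mulrC -cintZ//; last exact: cintegrable_ee.
  by apply: eq_cint => t _; rewrite /K/= mulrA; congr (_ * ee _); ring.
have [mfR mfI] := cintegrable_meas fi; have [mgR mgI] := cintegrable_meas gi.
apply: (@cint_exchange _ K (fun t => `|complex.Re (f t)| + `|complex.Im (f t)|)
  (fun t => `|complex.Re (g t)| + `|complex.Im (g t)|)).
- have mee : cmeas (setT : set (RR * RR)%type) (fun z : RR * RR => ee (z.1 * - z.2)).
    have mz : measurable_fun (setT : set (RR * RR)%type)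
        (fun z : RR * RR => 2 * pi * (z.1 * - z.2)).
      apply: measurable_funM; first exact: measurable_cst.
      by apply: measurable_funM; [exact: measurable_fst|exact: measurableT_comp].
    split; under eq_fun do rewrite ?ReEe ?ImEe.
    + exact: measurableT_comp (continuous_measurable_fun (@continuous_cos R)) mz.
    + exact: measurableT_comp (continuous_measurable_fun (@continuous_sin R)) mz.
  apply: cmeasM => //; apply: cmeasM; split.
  + exact: measurableT_comp mfR measurable_fst.
  + exact: measurableT_comp mfI measurable_fst.
  + exact: measurableT_comp mgR measurable_snd.
  + exact: measurableT_comp mgI measurable_snd.
- by move=> t; rewrite addr_ge0.
- by move=> t; rewrite addr_ge0.
- exact: cintegrable_norm1.
- exact: cintegrable_norm1.
- by move=> t x; case: (bound_normM_ee (f t) (g x) (t * - x)).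
- by move=> t x; case: (bound_normM_ee (f t) (g x) (t * - x)).
Qed.

End fourier.

(** * Plancherel for compact support, and density of the transforms *)

Section compact_support.
Context {R : realType}.
Notation mu := (@lebesgue_measure R).
Notation RR := (measurableTypeR R).
Implicit Types (f g : R -> R[i]) (L : R).

Let mT : measurable (setT : set RR). Proof. exact: measurableT. Qed.
Let mI L : measurable (`]- L, L[%classic : set RR). Proof. exact: measurable_itv. Qed.

Definition supported L f := forall t, ~ `]- L, L[%classic t -> f t = 0.

Lemma cint_supported L f : supported L f -> cint mu setT f = cint mu `]- L, L[ f.
Proof.
move=> sf; apply: complexP; rewrite ?Re_cint ?Im_cint [RHS]Rintegral_mkcond;
  apply: eq_Rintegral => t _; rewrite patchE; case: ifPn => //;
  by rewrite notin_setE => /sf ->.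
Qed.

Lemma nrm_supported L f : supported L f -> nrm mu setT f = nrm mu `]- L, L[ f.
Proof.
move=> sf; rewrite /nrm [RHS]Rintegral_mkcond; apply: eq_Rintegral => t _.
by rewrite patchE; case: ifPn => //; rewrite notin_setE => /sf ->; rewrite normsq0.
Qed.

Lemma L2on_subT (D : set RR) f : measurable D -> L2on mu setT f -> L2on mu D f.
Proof.
move=> mD [mf fi]; split; first exact: (cmeasS mT).
exact: integrableS fi.
Qed.

Definition trunc L f t : R[i] := f t * (\1_(`]- L, L[%classic : set R) t)%:C.

Lemma truncE L f t : trunc L f t = if (- L < t < L) then f t else 0.
Proof.
rewrite /trunc indicE mem_setE/= in_itv/=.
by case: ifP => _; rewrite ?mulr1 ?mulr0.
Qed.

Lemma supported_trunc L f : supported L (trunc L f).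
Proof. by move=> t; rewrite /= in_itv/= truncE => /negP/negPf ->. Qed.

Lemma cmeas_trunc D L f : measurable (D : set RR) ->
  cmeas (D : set RR) f -> cmeas (D : set RR) (trunc L f).
Proof.
move=> mD mf; apply: cmeasM => //; split; last exact: measurable_cst.
by apply: measurable_funTS; exact: measurable_indic.
Qed.

Lemma L2on_trunc L f : L2on mu setT f -> L2on mu setT (trunc L f).
Proof.
move=> fi; case: (fi) => mf ii; apply: (L2on_le mT _ ii); first exact: cmeas_trunc.
by move=> t _; rewrite truncE; case: ifP => // _; rewrite normsq0 normsq_ge0.
Qed.

(** The truncation and the remainder have disjoint supports, so their squared norms add. *)
Lemma nrmB_trunc L f : L2on mu setT f ->
  nrm mu setT (fun t => f t - trunc L f t) = nrm mu setT f - nrm mu setT (trunc L f).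
Proof.
move=> fi; case: (fi) => mf ii; case: (L2on_trunc L fi) => mtf iit.
rewrite /nrm -RintegralB//; apply: eq_Rintegral => t _.
by rewrite truncE; case: ifP => _; rewrite ?subr0 ?subrr ?normsq0 ?subr0// subrr.
Qed.

Lemma trunc_approx f e : L2on mu setT f -> 0 < e ->
  exists2 L, 0 < L & nrm mu setT (fun t => f t - trunc L f t) <= e.
Proof.
move=> fi e0; case: (fi) => mf ii.
have mF n : cmeas (setT : set RR) (fun t => f t - trunc n.+1%:R f t).
  by apply: cmeasB => //; exact: cmeas_trunc.
have Fb n t : setT t -> normsq (f t - trunc n.+1%:R f t) <= normsq (f t).
  by move=> _; rewrite truncE; case: ifP => _; rewrite ?subrr ?subr0// normsq0 normsq_ge0.
have F0 t : setT t -> (fun n => normsq (f t - trunc n.+1%:R f t)) @ \oo --> 0.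
  move=> _; apply: cvg_near_cst; exists (Num.truncn `|t|) => // n /= tn.
  rewrite truncE -ltr_norml (lt_le_trans (truncnS_gt _)) ?subrr ?normsq0//.
  by rewrite ler_nat ltnS.
by have [n ne] := nrm_cvg0 mT mF ii Fb F0 e0; exists n.+1%:R.
Qed.

(** f is the product of itself and the indicator of a bounded interval, both square integrable. This
    makes [fourier] a convergent integral on the class of functions used here. *)
Lemma cintegrable_supported L f : L2on mu setT f -> supported L f -> cintegrable mu setT f.
Proof.
move=> fi sf.
have i1 : L2on mu setT (fun t => (\1_(`]- L, L[%classic : set R) t)%:C).
  split.
    by split; [exact: measurable_indic|exact: measurable_cst].
  have : mu.-integrable (setT : set RR) (EFin \o \1_(`]- L, L[%classic : set RR)).
    exact: integrable_indic_itv.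
  apply: eq_integrable => // t _ /=; rewrite normsqC indicE.
  by case: (_ \in _); rewrite ?expr1n ?expr0n.
apply: eq_cintegrable (L2on_mul mT fi i1) => // t _.
rewrite indicE; case: (boolP (t \in _)) => [_|]; first by rewrite mulr1.
by rewrite notin_setE => /sf ->; rewrite mul0r.
Qed.

(* For f supported in ]-L, L[, Parseval on that interval gives
   \sum_n |fourier f (x + n / 2L)|^2 = 2L |f|^2 for every x; integrate over x in
   one period. *)
Lemma plancherel L f : 0 < L -> L2on mu setT f -> supported L f ->
  (\int[mu]_x (normsq (fourier f x))%:E = (nrm mu setT f)%:E)%E.
Proof.
move=> L0 fi sf; have fc := cintegrable_supported fi sf.
pose T := L + L; have T0 : 0 < T by rewrite addr_gt0.
have TL : - L + T = L by rewrite /T; ring.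
have s0 : 0 < T^-1 by rewrite invr_gt0.
have mF : measurable_fun (setT : set RR) (fun x => (normsq (fourier f x))%:E).
  by apply: measurable_normsqE; exact: cmeas_fourier.
rewrite (ge0_integral_tile 0 s0 mF); last by move=> x; rewrite lee_fin normsq_ge0.
have fiI : L2on mu `]- L, - L + T[ f by apply: L2on_subT => //; rewrite TL.
transitivity (\int[mu]_(x in `[0%R, (0 + T^-1)%R[) (T * nrm mu setT f)%:E)%E.
  apply: eq_integral => x _.
  have gi : L2on mu `]- L, - L + T[ (fun t => f t * ee (t * - x)).
    apply: L2onM_bounded => //; first exact: cmeas_ee.
    by exists 1 => t _; rewrite normsq_ee.
  transitivity (\esum_(n in [set: int])
      (normsq (coef (- L) T (fun t => f t * ee (t * - x)) n))%:E)%E.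
    apply: eq_esum => n _; congr (normsq _)%:E; rewrite /fourier (@cint_supported L).
      rewrite /coef TL; apply: eq_cint => t _.
      by rewrite /en eeJ -mulrA -eeD; congr (_ * ee _); ring.
    by move=> t /sf ->; rewrite mul0r.
  rewrite parseval//; congr (_ * _)%:E; rewrite (nrm_supported sf) TL.
  by apply: eq_nrm => t _; rewrite normsqM normsq_ee mulr1.
rewrite (integral_cst mu _ (T * nrm mu setT f)%:E)//= lebesgue_measure_itv/= add0r.
rewrite lte_fin s0 sube0 -EFinM; congr EFin.
by field; rewrite gt_eqF.
Qed.

Lemma fourier_L2 L f : 0 < L -> L2on mu setT f -> supported L f ->
  L2on mu setT (fourier f) /\ nrm mu setT (fourier f) = nrm mu setT f.
Proof.
move=> L0 fi sf; have pl := plancherel L0 fi sf.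
have mF := cmeas_fourier (cintegrable_supported fi sf).
have li : L2on mu setT (fourier f).
  split => //; apply/integrableP; split; first exact: measurable_normsqE.
  under eq_integral do rewrite gee0_abs ?lee_fin ?normsq_ge0//.
  by rewrite pl ltry.
by split => //; apply: EFin_inj; rewrite -pl nrmE.
Qed.

(** The multiplication formula moves the transform from h to K, so [hE] turns the cross term into -
    2 |h|^2. This takes the place of Fourier inversion. *)
Lemma nrmB_conj_fourier L L' K h : 0 < L -> 0 < L' ->
  L2on mu setT K -> supported L K -> L2on mu setT h -> supported L' h ->
  (forall t, h t * fourier K t = (normsq (h t))%:C) ->
  nrm mu setT (fun x => K x - conjc (fourier h x)) = nrm mu setT K - nrm mu setT h.
Proof.
move=> L0 L'0 Ki sK hi sh hE; have [Fhi Fhn] := fourier_L2 L'0 hi sh.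
rewrite nrmD//; last by apply: L2onN => //; exact: L2onJ.
rewrite nrmN nrmJ Fhn.
have -> : cint mu setT (fun x => K x * conjc (- conjc (fourier h x))) =
    - cint mu setT (fun x => fourier h x * K x).
  rewrite -mulN1r -cintZ//; last exact: L2on_mul.
  by apply: eq_cint => x _; apply: complexP; rewrite !ReImE; ring.
rewrite -fourier_mult; [|exact: (cintegrable_supported hi sh)|exact: (cintegrable_supported Ki sK)].
have -> : cint mu setT (fun t => h t * fourier K t) = (nrm mu setT h)%:C.
  rewrite (@eq_cint _ _ _ mu _ _ (fun t => (normsq (h t))%:C)); last by move=> t _.
  apply: complexP; rewrite ?Re_cint ?Im_cint //=.
  by rewrite /Rintegral integral0.
have -> : complex.Re (- (nrm mu setT h)%:C) = - nrm mu setT h by [].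
ring.
Qed.

(* With K a truncation of G and h a truncation of conj (fourier K), the
   multiplication formula gives <K, conj (fourier h)> = |h|^2, so that
   |K - conj (fourier h)|^2 = |K|^2 - |h|^2 = |conj (fourier K) - h|^2. *)
Lemma fourier_dense G e : L2on mu setT G -> 0 < e ->
  exists L h, [/\ 0 < L, L2on mu setT h, supported L h &
    nrm mu setT (fun x => G x - conjc (fourier h x)) <= e].
Proof.
move=> Gi e0; have e4 : 0 < e / 4 by rewrite divr_gt0.
have [M M0 GM] := trunc_approx Gi e4.
have [K [Ki sK GK]] : exists K, [/\ L2on mu setT K, supported M K &
    nrm mu setT (fun t => G t - K t) <= e / 4].
  by exists (trunc M G); split => //; [exact: L2on_trunc|exact: supported_trunc].
have [FKi FKn] := fourier_L2 M0 Ki sK.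
have FKJ := L2onJ FKi.
have [L L0 FKL] := trunc_approx FKJ e4.
have [h [hi sh hE KK]] : exists h, [/\ L2on mu setT h, supported L h,
    forall t, h t * fourier K t = (normsq (h t))%:C &
    nrm mu setT K - nrm mu setT h <= e / 4].
  exists (trunc L (fun t => conjc (fourier K t))); split.
  - exact: L2on_trunc.
  - exact: supported_trunc.
  - move=> t; rewrite truncE; case: ifP => _; last by rewrite mul0r normsq0.
    by rewrite normsqJ mulrC mulJ_normsq.
  - by rewrite nrmB_trunc// nrmJ FKn in FKL.
have [Fhi _] := fourier_L2 L0 hi sh.
exists L, h; split => //.
rewrite -(nrmB_conj_fourier M0 L0 Ki sK hi sh hE) in KK.
have := nrmD_le mT (L2onB mT Gi Ki) (L2onB mT Ki (L2onJ Fhi)).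
rewrite (@eq_nrm _ _ _ mu _ (fun x => G x - K x + (K x - conjc (fourier h x)))
  (fun x => G x - conjc (fourier h x))); last by move=> t _; congr normsq; ring.
move=> H; apply: (le_trans H); have := lerD GK KK; move: (_ + _) => S HS.
rewrite (le_trans (ler_wpM2l _ HS))//.
by have := e4; lra.
Qed.

End compact_support.

(** * The Gabor window *)

Section window.
Context {R : realType}.
Notation mu := (@lebesgue_measure R).
Notation RR := (measurableTypeR R).
Variables (N : nat) (a w : 'I_N -> R[i]) (alpha : R).
Hypothesis w0 : forall k, complex.Re (w k) != 0.
Hypothesis alpha0 : 0 < alpha.
Notation T := (alpha^-1).
Notation I := (`]0%R, (0 + T)%R[%classic : set R).

Let T0 : 0 < T. Proof. by rewrite invr_gt0. Qed.

(** Replacing y k by 0 gives a product over all indices, whose expansion over subsets keeps only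
    those that avoid k. These have fewer than N elements, so s < N suffices. *)
Lemma prod_add1_except (S : comNzRingType) (y : 'I_N -> S) (k : 'I_N) :
  \prod_(j | j != k) (1 + y j) =
  \sum_(s < N) \sum_(J : {set 'I_N} | (k \notin J) && (#|J| == s)) \prod_(j in J) y j.
Proof.
transitivity (\prod_j ((if j == k then 0 else y j) + 1)).
  rewrite [RHS](bigD1 k)//= eqxx add0r mul1r; apply: eq_bigr => j /negPf ->.
  by rewrite addrC.
rewrite bigA_distr (bigID (fun J : {set 'I_N} => k \in J))/= big1 ?add0r; last first.
  by move=> J kJ; rewrite (bigD1 k)//= kJ eqxx mul0r.
have lt (J : {set 'I_N}) : k \notin J -> (#|J| < N)%N.
  move=> kJ; rewrite -[X in (_ < X)%N]card_ord; apply: proper_card.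
  by apply/properP; split; [exact/fintype.subsetP|exists k].
have N0 : (0 < N)%N by apply: leq_ltn_trans (ltn_ord k).
(* The default value of [insubd] concerns only cardinalities at least N, which no subset avoiding k
   attains. *)
rewrite (partition_big (fun J : {set 'I_N} => insubd (Ordinal N0) #|J|) xpredT)//=.
apply: eq_bigr => s _; apply: eq_big => [J|J /andP[kJ _]].
  case kJ : (k \in J) => //=; rewrite -val_eqE val_insubd lt ?kJ//.
rewrite [RHS]big_mkcond; apply: eq_bigr => j _; case: ifP => // jJ.
by case: eqP => // jk; rewrite -jk jJ in kJ.
Qed.

(** The z_k of the overview. The conjugate of g, extended to complex t, has its k-th pole at t = - i
    conj w_k, which is where conj z_k e(- t / alpha) equals 1. *)
Definition pole (k : 'I_N) : R[i] := cexp ((2 * pi / alpha)%:C * w k).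

Definition window_mult (t : R) : R[i] := \prod_(k < N) (1 - conjc (pole k) * ee (t * - T)).

Lemma AcoefE k s : Acoef w alpha k s =
  (-1) ^+ s * \sum_(J : {set 'I_N} | (k \notin J) && (#|J| == s)) \prod_(j in J) pole j.
Proof.
rewrite /Acoef; congr (_ * _); apply: eq_bigr => J _.
by rewrite mulr_sumr cexp_sum.
Qed.

Lemma ee_natM n x : ee (n%:R * x) = ee x ^+ n :> R[i].
Proof.
elim: n => [|n IH]; first by rewrite mul0r ee0 expr0.
by rewrite -natr1 mulrDl mul1r eeD IH exprSr.
Qed.

(** The origin of A_{k,s}: up to conjugation they are the coefficients of the multiplier with its
    k-th factor removed, as a polynomial in e(- t / alpha). *)
Lemma window_mult_except k t : \prod_(j | j != k) (1 - conjc (pole j) * ee (t * - T)) =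
  \sum_(s < N) conjc (Acoef w alpha k s) * ee (t * - (s%:R / alpha)).
Proof.
under eq_bigr do rewrite -mulNr.
rewrite (@prod_add1_except _ (fun j => - conjc (pole j) * ee (t * - T))).
apply: eq_bigr => s _; rewrite AcoefE.
have -> : t * - (s%:R / alpha) = s%:R * (t * - T) by ring.
rewrite ee_natM rmorphM rmorphXn rmorphN1 rmorph_sum mulr_sumr mulr_suml.
apply: eq_bigr => J /andP[_ /eqP Js].
under eq_bigr => j _ do rewrite -mulN1r -mulrA.
by rewrite !big_split/= !prodr_const Js rmorph_prod mulrA.
Qed.

(* The zero of 1 - conj (pole k) e(-t/alpha) cancels the pole of conj g, so the
   quotient is the Fourier transform of an exponential cut off to one period,
   whatever the sign of Re (w k). *)
Lemma pole_factor k t :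
  (1 - conjc (pole k) * ee (t * - T)) / (t%:C + 'i%C * conjc (w k)) =
  (2 * pi)%:C * 'i%C * cint mu I
    (fun x => cexp (x%:C * ((2 * pi)%:C * conjc (w k))) * ee (x * - t)).
Proof.
set q := conjc (w k) - 'i%C * t%:C.
have iq : t%:C + 'i%C * conjc (w k) = 'i%C * q.
  by apply: complexP; rewrite /q !ReImE/=; ring.
have i0 : 'i%C != 0 :> R[i] by rewrite eq_complex/= oner_eq0 andbF.
have q0 : q != 0.
  rewrite eq_complex negb_and; apply/orP; left.
  by rewrite /q !ReImE/= !mul0r mulr0 subr0 oppr0 addr0.
pose b := (2 * pi)%:C * q.
have TT : 0 < 0 + T by rewrite add0r.
have := cint_cexpM b TT.
rewrite (@cint_itv_bndoo _ 0 (0 + T) true false); last exact: cmeas_cexpM.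
have -> : cexp ((0 + T)%:C * b) = conjc (pole k) * ee (t * - T).
  rewrite /pole cexpJ -cexpD; congr cexp.
  by apply: complexP; rewrite /b /q !ReImE/= ?add0r; ring.
rewrite mul0r cexp0 iq => E.
have -> : cint mu I (fun x => cexp (x%:C * ((2 * pi)%:C * conjc (w k))) * ee (x * - t)) =
    cint mu I (fun x => cexp (x%:C * b)).
  apply: eq_cint => x _; rewrite /ee -cexpD; congr cexp.
  by apply: complexP; rewrite /b /q !ReImE/=; ring.
rewrite -opprB -E /b; set X := cint _ _ _.
have ii : 'i%C * 'i%C = -1 :> R[i] by rewrite -sqr_i expr2.
apply: (mulIf (mulf_neq0 i0 q0)); rewrite divfK ?mulf_neq0//.
rewrite -[LHS]mulN1r -ii; ring.
Qed.

End window.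

(** * Gabor coefficients as Fourier coefficients on one period *)

Section gabor_identity.
Context {R : realType}.
Notation mu := (@lebesgue_measure R).
Notation RR := (measurableTypeR R).
Variables (N : nat) (a w : 'I_N -> R[i]) (alpha : R).
Hypothesis w0 : forall k, complex.Re (w k) != 0.
Hypothesis alpha0 : 0 < alpha.
Notation T := (alpha^-1).
Notation I := (`]0%R, (0 + T)%R[%classic : set R).

Let T0 : 0 < T. Proof. by rewrite invr_gt0. Qed.
Let mT : measurable (setT : set RR). Proof. exact: measurableT. Qed.
Let mI : measurable (I : set RR). Proof. exact: measurable_itv. Qed.

Lemma patch_indic (D : set RR) (f : R -> R[i]) x :
  f x * (\1_D x)%:C = if x \in D then f x else 0.
Proof. by rewrite indicE; case: ifP => _; rewrite ?mulr1 ?mulr0. Qed.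

Lemma cint_indic (D : set RR) (f : R -> R[i]) :
  cint mu setT (fun x => f x * (\1_D x)%:C) = cint mu D f.
Proof.
apply: complexP; rewrite ?Re_cint ?Im_cint [RHS]Rintegral_mkcond;
  by apply: eq_Rintegral => t _; rewrite patchE patch_indic; case: ifP.
Qed.

Lemma cmeas_shift (G : R -> R[i]) c : cmeas (setT : set RR) G ->
  cmeas (setT : set RR) (fun x => G (x + c)).
Proof.
by move=> [mR mJ]; have ms := @measurable_shift R c; split;
  [exact: (measurableT_comp mR ms)|exact: (measurableT_comp mJ ms)].
Qed.

Lemma L2on_shift (f : R -> R[i]) c : L2on mu setT f ->
  L2on mu setT (fun x => f (x + c)).
Proof.
move=> [mf0 fi]; have mf := cmeas_shift c mf0.
split=> //; apply/integrableP; split; first exact: measurable_normsqE.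
have -> : (\int[mu]_x `|(normsq (f (x + c)))%:E| = \int[mu]_x (normsq (f x))%:E)%E.
  rewrite -[RHS](ge0_integral_shiftT c (f := fun x => (normsq (f x))%:E)).
  - by apply: eq_integral => x _; rewrite gee0_abs ?lee_fin ?normsq_ge0.
  - exact: measurable_normsqE.
  - by move=> x; rewrite lee_fin normsq_ge0.
have [_] := integrableP _ _ _ fi.
by under eq_integral do rewrite gee0_abs ?lee_fin ?normsq_ge0//.
Qed.

Lemma mfunE s x : Defs.mfun a w alpha s x =
  \sum_(k < N) (a k * Acoef w alpha k s) * cexp (x%:C * ((2 * pi)%:C * w k)).
Proof.
apply: eq_bigr => k _; congr (_ * cexp _).
by apply: complexP; rewrite !ReImE/=; ring.
Qed.

Lemma cmeas_mfun (D : set RR) s : measurable D -> cmeas D (Defs.mfun a w alpha s).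
Proof.
move=> mD; apply: (@eq_cmeas _ _ _ D (fun x => \sum_(k < N) (a k * Acoef w alpha k s) *
    cexp (x%:C * ((2 * pi)%:C * w k)))); first by move=> x _; rewrite mfunE.
apply: cmeas_sum => k _; apply: cmeasM; first exact: cmeas_cst.
exact: cmeas_cexpM.
Qed.

Lemma mfun_bounded : exists2 M : R, 0 <= M & forall (s : 'I_N) x, 0 <= x <= T ->
  normsq (Defs.mfun a w alpha s x) <= M.
Proof.
pose B (s : 'I_N) := 2 ^+ N * \sum_(k < N) (normsq (a k * Acoef w alpha k s) *
  expR (2 * pi * T * `|complex.Re (w k)|) ^+ 2).
have B0 s : 0 <= B s.
  by rewrite mulr_ge0 ?exprn_ge0// sumr_ge0// => k _; rewrite mulr_ge0 ?normsq_ge0 ?sqr_ge0.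
(* The sum of the bounds serves as one bound common to all s. *)
exists (\sum_s B s); first by rewrite sumr_ge0.
move=> s x /andP[x0 xT]; rewrite (bigD1 s)//= ler_wpDr ?sumr_ge0//.
rewrite mfunE (le_trans (normsq_sum_le _))// ler_wpM2l ?exprn_ge0// ler_sum// => k _.
rewrite normsqM ler_wpM2l ?normsq_ge0// normsq_cexp.
rewrite ler_sqr ?nnegrE ?expR_ge0// ler_expR.
have -> : complex.Re (x%:C * ((2 * pi)%:C * w k)) = (2 * pi * x) * complex.Re (w k).
  by rewrite !ReImE/=; ring.
apply: (le_trans (ler_norm _)); rewrite normrM ger0_norm ?mulr_ge0 ?pi_ge0//.
by rewrite ler_wpM2r// ler_wpM2l ?mulr_ge0 ?pi_ge0.
Qed.

Definition window_part (s : 'I_N) (x : R) : R[i] :=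
  conjc (Defs.mfun a w alpha s x) * (\1_I x)%:C.

Lemma window_partE s x :
  window_part s x = if 0 < x < T then conjc (Defs.mfun a w alpha s x) else 0.
Proof.
rewrite /window_part indicE mem_setE/= in_itv/= add0r.
by case: ifP => _; rewrite ?mulr1 ?mulr0.
Qed.

Lemma fourier_window_part s t : fourier (window_part s) t =
  \sum_(k < N) conjc (a k * Acoef w alpha k s) *
    cint mu I (fun x => cexp (x%:C * ((2 * pi)%:C * conjc (w k))) * ee (x * - t)).
Proof.
have -> : fourier (window_part s) t =
    cint mu I (fun x => conjc (Defs.mfun a w alpha s x) * ee (x * - t)).
  by rewrite -cint_indic; apply: eq_cint => x _; rewrite /window_part mulrAC.
have ii k : cintegrable mu I
    (fun x => cexp (x%:C * ((2 * pi)%:C * conjc (w k))) * ee (x * - t)).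
  apply: cintegrable_ee => //; have [iR iI] := cintegrable_cexpM 0 (0 + T) ((2 * pi)%:C * conjc (w k)).
  have sub : (I : set RR) `<=` `[0, 0 + T] by exact: subset_itv_oo_cc.
  by split; [apply: integrableS iR => //|apply: integrableS iI => //]; exact: measurable_itv.
transitivity (cint mu I (fun x => \sum_(k < N) conjc (a k * Acoef w alpha k s) *
    (cexp (x%:C * ((2 * pi)%:C * conjc (w k))) * ee (x * - t)))).
  apply: eq_cint => x _; rewrite mfunE cJ_sum mulr_suml; apply: eq_bigr => k _.
  rewrite (cJM (a k * _)) cexpJ -mulrA; congr (_ * (_ * _)); congr cexp.
  by apply: complexP; rewrite !ReImE/=; ring.
by rewrite cint_sum// => [|k]; [apply: eq_bigr => k _; rewrite cintZ//|exact: cintegrableZ].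
Qed.

Lemma window_multE t : window_mult w alpha t * conjc (gfun a w t) =
  (2 * pi)%:C * 'i%C * \sum_(s < N) ee (t * - (s%:R / alpha)) * fourier (window_part s) t.
Proof.
have -> : conjc (gfun a w t) = \sum_(k < N) conjc (a k) / (t%:C + 'i%C * conjc (w k)).
  rewrite /gfun cJ_sum; apply: eq_bigr => k _.
  rewrite cJM conjc_inv; congr (_ / _).
  by apply: complexP; rewrite !ReImE/=; ring.
under [X in _ = _ * X]eq_bigr do rewrite fourier_window_part mulr_sumr.
rewrite exchange_big/= !mulr_sumr; apply: eq_bigr => k _.
(* In the k-th summand the k-th factor absorbs the pole, and the remaining factors are expanded. *)
have -> : window_mult w alpha t = (1 - conjc (pole w alpha k) * ee (t * - T)) *
    \sum_(s < N) conjc (Acoef w alpha k s) * ee (t * - (s%:R / alpha)).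
  by rewrite -window_mult_except /window_mult (bigD1 k).
rewrite mulrAC mulrCA pole_factor//.
set E := cint _ _ _; rewrite !mulr_sumr; apply: eq_bigr => s _.
by rewrite cJM; ring.
Qed.

Lemma window_mult_periodic t (m : int) :
  window_mult w alpha (t - alpha * m%:~R) = window_mult w alpha t.
Proof.
apply: eq_bigr => k _; congr (_ - _ * _).
have -> : (t - alpha * m%:~R) * - T = t * - T + m%:~R by field; rewrite gt_eqF.
by rewrite eeD ee_int mulr1.
Qed.

(** The radius T + 1 is only a convenient one for a symmetric interval that contains ]0, T[. The
    frequency y is alpha m in [inner_gabor], and 0 for the bare function. *)
Lemma L2on_window_part s y : L2on mu setT (fun x => window_part s x * ee (x * y)) /\
  supported (T + 1) (fun x => window_part s x * ee (x * y)).
Proof.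
have T1 : 0 < T + 1 by rewrite addr_gt0.
have [M M0 mM] := mfun_bounded.
split; last first.
  move=> x; rewrite /= in_itv/= => /negP xT; rewrite window_partE.
  case: ifPn => [/andP[x0 xT']|_]; last by rewrite mul0r.
  have TT : 0 < T := T0; exfalso; move: xT; rewrite negb_and -!leNgt => /orP[] xT1; lra.
apply: L2onM_bounded => //; last by exists 1 => t _; rewrite normsq_ee.
  have mv : cmeas (setT : set RR) (window_part s).
    apply: cmeasM; first by apply: cmeasJ; exact: cmeas_mfun.
    by split; [exact: measurable_indic|exact: measurable_cst].
  have i1 : mu.-integrable (setT : set RR) (EFin \o \1_I) by exact: integrable_indic_itv.
  apply: (@L2on_le _ _ _ mu setT mT _ (fun x => M * \1_I x)) => //.
    by have := integrableZl mT M i1; apply: eq_integrable.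
  move=> x _; rewrite window_partE indicE mem_setE/= in_itv/= add0r.
  case: ifPn => xI; last by rewrite normsq0 mulr0.
  by rewrite normsqJ mulr1 mM//; case/andP: xI => /ltW -> /ltW ->.
exact: cmeas_ee.
Qed.

(* The complex conjugate of the sum over s in [cond2], for G = conj (fourier h). *)
Definition fiber (h : R -> R[i]) (n : int) (x : R) : R[i] :=
  \sum_(s < N) conjc (Defs.mfun a w alpha s x) * fourier h (x + n%:~R + s%:R / alpha).

Lemma L2on_fiber_term (L : R) h n (s : 'I_N) : 0 < L -> L2on mu setT h -> supported L h ->
  L2on mu I (fun x => conjc (Defs.mfun a w alpha s x) *
    fourier h (x + n%:~R + s%:R / alpha)).
Proof.
move=> L0 hi sh; have [Fhi _] := fourier_L2 L0 hi sh.
have [M M0 mM] := mfun_bounded.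
have Fsi : L2on mu I (fun x => fourier h (x + n%:~R + s%:R / alpha)).
  apply: L2on_subT => //.
  have := L2on_shift (n%:~R + s%:R / alpha) Fhi.
  by apply: eq_L2on => // x _; rewrite addrA.
have mJ : cmeas (I : set RR) (fun x => conjc (Defs.mfun a w alpha s x)).
  by apply: cmeasJ; exact: cmeas_mfun.
have bJ : exists M, forall x, I x -> normsq (conjc (Defs.mfun a w alpha s x)) <= M.
  exists M => x; rewrite /= in_itv/= add0r => /andP[x0 xT].
  by rewrite normsqJ mM// !ltW.
by apply: (eq_L2on mI _ (L2onM_bounded mI Fsi mJ bJ)) => x _; rewrite mulrC.
Qed.

Lemma L2on_fiber (L : R) h n : 0 < L -> L2on mu setT h -> supported L h ->
  L2on mu I (fiber h n).
Proof. by move=> L0 hi sh; apply: L2on_sum => // s; exact: (L2on_fiber_term n s L0 hi sh). Qed.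

(** The multiplication formula exchanges the roles of the two shifts: the frequency n becomes a
    translation of [fourier h], and the time shift alpha m becomes the character e(alpha m x) of
    period T. That character is the conjugate of the exponential of index - m, hence the sign. *)
Lemma inner_gabor (L : R) h m n : 0 < L -> L2on mu setT h -> supported L h ->
  inner (fun t => window_mult w alpha t * h t) (gabor_atom (gfun a w) alpha m n) =
  coef 0 T (fun x => (2 * pi)%:C * 'i%C * fiber h n x) (- m).
Proof.
move=> L0 hi sh; have hc := cintegrable_supported hi sh.
have [Fhi _] := fourier_L2 L0 hi sh.
have T1 : 0 < T + 1 by rewrite addr_gt0.
set c := (2 * pi)%:C * 'i%C.
(* The modulation in u shifts the transform of h by n + s / alpha. The one in v shifts the transform
   of the window part by alpha m. *)
pose u (s : 'I_N) t := h t * ee (t * - (n%:~R + (s : nat)%:R / alpha)).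
pose v (s : 'I_N) x := window_part s x * ee (x * (alpha * m%:~R)).
have vi s : L2on mu setT (v s) by case: (L2on_window_part s (alpha * m%:~R)).
have sv s : supported (T + 1) (v s) by case: (L2on_window_part s (alpha * m%:~R)).
have ui s : L2on mu setT (u s).
  apply: L2onM_bounded => //; first exact: cmeas_ee.
  by exists 1 => t _; rewrite normsq_ee.
have su s : supported L (u s) by move=> t /sh ht; rewrite /u ht mul0r.
have uc s := cintegrable_supported (ui s) (su s).
have vc s := cintegrable_supported (vi s) (sv s).
have uv (s : 'I_N) : cintegrable mu setT (fun t => u s t * fourier (v s) t).
  by apply: L2on_mul => //; case: (fourier_L2 T1 (vi s) (sv s)).
rewrite -[LHS]/(cint mu setT (fun t => window_mult w alpha t * h t *
  conjc (gabor_atom (gfun a w) alpha m n t))).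
transitivity (cint mu setT (fun t => c * \sum_(s < N) (u s t * fourier (v s) t))).
  apply: eq_cint => t _.
  have -> : conjc (gabor_atom (gfun a w) alpha m n t) =
      ee (t * - n%:~R) * conjc (gfun a w (t - alpha * m%:~R)).
    rewrite /gabor_atom cJM; congr (_ * _).
    by rewrite cexpJ; congr cexp; apply: complexP => /=; ring.
  rewrite -(window_mult_periodic t m).
  transitivity (h t * ee (t * - n%:~R) * (window_mult w alpha (t - alpha * m%:~R) *
    conjc (gfun a w (t - alpha * m%:~R)))); first by ring.
  rewrite window_multE mulrCA -/c mulr_sumr; congr (_ * _); apply: eq_bigr => s _.
  have -> : fourier (v s) t = fourier (window_part s) (t - alpha * m%:~R).
    apply: eq_cint => x _; rewrite /v -mulrA -eeD; congr (_ * ee _); ring.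
  rewrite mulrA; congr (_ * _); rewrite /u -!mulrA -!eeD; congr (_ * _).
  (* Here the shift by alpha m drops out of the s-th exponential: it leaves e(m s), with m s an
     integer. *)
  have -> : t * - n%:~R + (t - alpha * m%:~R) * - (s%:R / alpha) =
      t * - (n%:~R + s%:R / alpha) + (m * s%:Z)%:~R.
    by rewrite rmorphM/= -pmulrn; field; rewrite gt_eqF.
  by rewrite eeD ee_int mulr1.
rewrite cintZ//; last exact: cintegrable_sum.
rewrite cint_sum//.
transitivity (c * \sum_(s < N) cint mu I (fun x =>
    conjc (Defs.mfun a w alpha s x) * fourier h (x + n%:~R + s%:R / alpha) *
    conjc (en T (- m) x))).
  congr (_ * _); apply: eq_bigr => s _.
  rewrite fourier_mult// -[RHS]cint_indic; apply: eq_cint => x _.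
  have -> : fourier (u s) x = fourier h (x + n%:~R + s%:R / alpha).
    by rewrite /u fourier_modulation addrA.
  have -> : conjc (en T (- m) x) = ee (x * (alpha * m%:~R)).
    by rewrite /en eeJ; congr ee; rewrite invrK rmorphN/=; ring.
  by rewrite /v /window_part; ring.
have Li (s : 'I_N) : L2on mu I (fun x => conjc (Defs.mfun a w alpha s x) *
    fourier h (x + n%:~R + s%:R / alpha)) by exact: (L2on_fiber_term n s L0 hi sh).
rewrite -cint_sum//; last by move=> s; apply: L2on_mulJ => //; exact: L2on_en.
rewrite -cintZ//; last first.
  by apply: cintegrable_sum => // s; apply: L2on_mulJ => //; exact: L2on_en.
apply: eq_cint => x _; rewrite /fiber -mulr_suml; ring.
Qed.

(** T is the factor of the unnormalised Parseval identity, and (2 pi)^2 is |2 pi i|^2. The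
    reindexing by - m undoes the sign in [inner_gabor]. *)
Lemma esum_inner_gabor (L : R) h n : 0 < L -> L2on mu setT h -> supported L h ->
  (\esum_(m in [set: int]) (normsq (inner (fun t => window_mult w alpha t * h t)
     (gabor_atom (gfun a w) alpha m n)))%:E =
  (T * (2 * pi) ^+ 2)%:E * \int[mu]_(x in `[0%R, T]) (normsq (fiber h n x))%:E)%E.
Proof.
move=> L0 hi sh.
have fi : L2on mu I (fiber h n) by exact: (L2on_fiber n L0 hi sh).
have bN : set_bij [set: int] [set: int] (fun m : int => - m).
  split; [by []|by move=> x y _ _ /oppr_inj|].
  by move=> y _; exists (- y) => //; rewrite opprK.
rewrite (reindex_esum _ _ _ _ bN).
under eq_esum do rewrite (inner_gabor _ _ L0 hi sh) opprK.
rewrite parseval//; last exact: L2onZ.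
rewrite nrmZ// normsqM normsqC (_ : normsq 'i%C = 1); last first.
  by rewrite /normsq/= expr0n expr1n add0r.
rewrite mulr1 mulrA EFinM -nrmE//; congr (_ * _)%E.
rewrite -(integral_itv_bndoo true false); first by rewrite add0r.
by apply: measurable_normsqE; case: fi; rewrite add0r.
Qed.

End gabor_identity.

(** * Frame bounds *)

Section fiber_bounds.
Context {R : realType}.
Notation mu := (@lebesgue_measure R).
Notation RR := (measurableTypeR R).
Variables (N : nat) (a w : 'I_N -> R[i]) (alpha : R).
Hypothesis w0 : forall k, complex.Re (w k) != 0.
Hypothesis alpha0 : 0 < alpha.
Notation T := (alpha^-1).
Notation m := (Defs.mfun a w alpha).

Let T0 : 0 < T. Proof. by rewrite invr_gt0. Qed.
Let mT : measurable (setT : set RR). Proof. exact: measurableT. Qed.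
Let mI : measurable (`[0%R, T]%classic : set RR). Proof. exact: measurable_itv. Qed.

Definition fib (G : R -> R[i]) (n : int) (x : R) : R[i] :=
  \sum_(s < N) G (x + n%:~R + s%:R / alpha) * m s x.

(** Convertible to the middle term of [cond2]. *)
Definition fiber_energy (G : R -> R[i]) : \bar R :=
  (\int[mu]_(x in `[0%R, T]) \esum_(n in [set: int]) (normsq (fib G n x))%:E)%E.

Lemma cmeas_fib (D : set RR) (G : R -> R[i]) n : cmeas (setT : set RR) G -> measurable D ->
  cmeas D (fib G n).
Proof.
move=> mG mD; apply: (cmeasS mT) => //; apply: cmeas_sum => s _.
apply: cmeasM; last exact: cmeas_mfun.
have := cmeas_shift (n%:~R + s%:R / alpha) mG.
by apply: eq_cmeas => x _; rewrite addrA.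
Qed.

Lemma esum_intZl (c : R) (f : int -> \bar R) : 0 <= c -> (forall n, (0 <= f n)%E) ->
  (\esum_(n in [set: int]) (c%:E * f n) = c%:E * \esum_(n in [set: int]) f n)%E.
Proof.
move=> c0 f0; have [e be] := int_nat_bij.
rewrite !(reindex_esum _ _ _ _ be) -!nneseries_esumT//.
  by rewrite nneseriesZl.
by move=> n; rewrite mule_ge0.
Qed.

Lemma fiber_energy_le2 G G1 G2 : cmeas (setT : set RR) G1 -> cmeas (setT : set RR) G2 ->
  (forall x, G x = G1 x + G2 x) ->
  (fiber_energy G <= 2%:E * fiber_energy G1 + 2%:E * fiber_energy G2)%E.
Proof.
move=> m1 m2 GE.
have mG : cmeas (setT : set RR) G.
  by apply: eq_cmeas (cmeasD m1 m2) => x _; rewrite GE.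
have ge0 (H : R -> R[i]) x : (0 <= \esum_(n in [set: int]) (normsq (fib H n x))%:E)%E.
  by apply: esum_ge0 => n _; rewrite lee_fin normsq_ge0.
have me (H : R -> R[i]) : cmeas (setT : set RR) H ->
    measurable_fun (`[0%R, T]%classic : set RR)
      (fun x => \esum_(n in [set: int]) (normsq (fib H n x))%:E)%E.
  move=> mH; apply: emeasurable_esum_int => n.
    by apply: measurable_normsqE; exact: cmeas_fib.
  by move=> x; rewrite lee_fin normsq_ge0.
rewrite /fiber_energy -!ge0_integralZl_EFin//; [|exact: me..].
rewrite -ge0_integralD//; last 4 first.
- by move=> x _; rewrite mule_ge0.
- by apply: measurable_funeM; exact: me.
- by move=> x _; rewrite mule_ge0.
- by apply: measurable_funeM; exact: me.
apply: ge0_le_integral => //.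
- exact: me.
- by apply: emeasurable_funD; apply: measurable_funeM; exact: me.
move=> x _.
have n0 (H : R -> R[i]) n : (0 <= (normsq (fib H n x))%:E)%E by rewrite lee_fin normsq_ge0.
rewrite -!esum_intZl//; rewrite -esumD; [|by move=> n _; rewrite mule_ge0..].
apply: le_esum => n _; rewrite -!EFinM -EFinD lee_fin -mulrDr.
have -> : fib G n x = fib G1 n x + fib G2 n x.
  by rewrite /fib -big_split; apply: eq_bigr => s _; rewrite GE mulrDl.
exact: normsqD_le.
Qed.

(** The inner sum is the 1-periodisation of F, with integral that of F over every unit interval.
    Whole unit intervals are used to cover [0, T], whose length need not be an integer. *)
Lemma integral_tiles (F : R -> \bar R) (K : nat) :
  measurable_fun (setT : set RR) F -> (forall x, (0 <= F x)%E) ->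
  (\int[mu]_(x in `[0%R, K%:R[) (\esum_(n in [set: int]) F (x + n%:~R * 1)%R) =
   K%:R%:E * \int[mu]_x F x)%E.
Proof.
move=> mF F0.
have mP (D : set RR) : measurable D -> measurable_fun D
    (fun x => \esum_(n in [set: int]) F (x + n%:~R * 1)%R)%E.
  move=> mD; apply: emeasurable_esum_int => // n.
  by apply: measurableT_comp => //; exact: measurable_funTS (measurable_shift _).
have P0 x : (0 <= \esum_(n in [set: int]) F (x + n%:~R * 1)%R)%E by apply: esum_ge0.
elim: K => [|K IH]; first by rewrite set_itvco0 integral_set0 mul0e.
have -> : `[0%R, K.+1%:R[%classic = `[0%R, K%:R[%classic `|` `[K%:R, K%:R + 1[%classic :> set R.
  apply/seteqP; split=> x /=; rewrite !in_itv/= -natr1.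
  - move=> /andP[x0 xK]; have [xk|kx] := ltP x K%:R; first by left; rewrite x0.
    by right; rewrite xK.
  - have K0 : 0 <= K%:R :> R by rewrite ler0n.
    by case=> /andP[u v]; apply/andP; split; lra.
rewrite ge0_integral_setU//=; last 2 first.
- by apply: mP; apply: measurableU; exact: measurable_itv.
- apply/disj_setPS => x /=; rewrite !in_itv/= => -[/andP[_ u] /andP[v _]].
  by move: (lt_le_trans u v); rewrite ltxx.
rewrite IH -(ge0_integral_tile K%:R ltr01 mF F0).
rewrite -natr1 EFinD ge0_muleDl ?mul1e//.
Qed.

(** Pointwise, the bound on the m_s leaves a finite sum of translates of |G|^2. Periodised and
    integrated over K unit intervals, each of them gives K times the squared norm of G. *)
Lemma fiber_energy_bounded : exists2 C : R, 0 < C & forall G, L2on mu setT G ->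
  (fiber_energy G <= (C * nrm mu setT G)%:E)%E.
Proof.
have [M M0 mM] := mfun_bounded a w alpha.
pose D := 2 ^+ N * M; have D0 : 0 <= D by rewrite mulr_ge0 ?exprn_ge0.
pose K := (Num.truncn T).+1.
(* The final + 1 ensures that the constant is positive even if the main term vanishes. *)
exists (K%:R * (D * N%:R) + 1); first by rewrite ltr_wpDl// !mulr_ge0.
move=> G Gi; case: (Gi) => mG iG.
have msh c : measurable_fun (setT : set RR) (fun x => (normsq (G (x + c)))%:E).
  by apply: measurable_normsqE; exact: cmeas_shift.
pose F x := (\sum_(s < N) D%:E * (normsq (G (x + s%:R / alpha)))%:E)%E.
have F0 x : (0 <= F x)%E.
  by apply: sume_ge0 => s _; rewrite mule_ge0 ?lee_fin ?normsq_ge0.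
have mF : measurable_fun (setT : set RR) F.
  by apply: emeasurable_sum => s; apply: measurable_funeM; exact: msh.
have FE : (\int[mu]_x F x = (D * N%:R * nrm mu setT G)%:E)%E.
  rewrite ge0_integral_sum//; last 2 first.
  - by move=> s; apply: measurable_funeM; exact: msh.
  - by move=> s x _; rewrite mule_ge0 ?lee_fin ?normsq_ge0.
  have e s : (\int[mu]_x (D%:E * (normsq (G (x + s%:R / alpha)%R))%:E) = (D * nrm mu setT G)%:E)%E.
    transitivity (D%:E * \int[mu]_x (normsq (G (x + s%:R / alpha)%R))%:E)%E.
      by apply: ge0_integralZl_EFin => // x _; rewrite lee_fin normsq_ge0.
    rewrite (ge0_integral_shiftT (s%:R / alpha) (f := fun x => (normsq (G x))%:E)).
    - by rewrite nrmE.
    - exact: measurable_normsqE.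
    - by move=> x; rewrite lee_fin normsq_ge0.
  rewrite (eq_bigr (fun=> (D * nrm mu setT G)%:E)) => [|s _]; last exact: e.
  by rewrite sumEFin sumr_const card_ord; congr EFin; rewrite -mulr_natr; ring.
have mE (J : set RR) : measurable J -> measurable_fun J
    (fun x => \esum_(n in [set: int]) F (x + n%:~R * 1)%R)%E.
  move=> mJ; apply: emeasurable_esum_int => // n.
  by apply: measurableT_comp => //; exact: measurable_funTS (measurable_shift _).
have E0 x : (0 <= \esum_(n in [set: int]) F (x + n%:~R * 1)%R)%E by apply: esum_ge0.
apply: (@le_trans _ _ (\int[mu]_(x in `[0%R, T]) \esum_(n in [set: int]) F (x + n%:~R * 1)%R)%E).
  apply: ge0_le_integral => //.
  - by move=> x _; apply: esum_ge0 => n _; rewrite lee_fin normsq_ge0.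
  - apply: emeasurable_esum_int => [n|n x]; last by rewrite lee_fin normsq_ge0.
    by apply: measurable_normsqE; exact: cmeas_fib.
  - exact: mE.
  move=> x; rewrite /= in_itv/= => xT; apply: le_esum => n _.
  rewrite /F mulr1; under eq_bigr do rewrite -EFinM.
  rewrite sumEFin lee_fin (le_trans (normsq_sum_le _))// /D -mulr_sumr -mulrA.
  rewrite ler_wpM2l ?exprn_ge0// mulr_sumr ler_sum// => s _.
  by rewrite normsqM mulrC ler_wpM2r ?normsq_ge0// mM.
apply: (@le_trans _ _ (\int[mu]_(x in `[0%R, K%:R[) \esum_(n in [set: int]) F (x + n%:~R * 1)%R)%E).
  apply: ge0_subset_integral => //; first by apply: mE; exact: measurable_itv.
  move=> x; rewrite /= !in_itv/= => /andP[-> xT]/=.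
  exact: le_lt_trans xT (truncnS_gt _).
rewrite integral_tiles// FE -EFinM lee_fin; have := nrm_ge0 mu setT G.
move: (nrm mu setT G) => x x0.
have -> : (K%:R * (D * N%:R) + 1) * x = K%:R * (D * N%:R * x) + x by ring.
by rewrite lerDl.
Qed.

End fiber_bounds.

Section weak_cauchy_schwarz.
Context d {T : measurableType d} {R : realType}.
Variable mu : {measure set T -> \bar R}.

Lemma normsqV (z : R[i]) : normsq z^-1 = (normsq z)^-1.
Proof.
have [->|z0] := eqVneq z 0; first by rewrite invr0 normsq0 invr0.
have n0 : normsq z != 0 by rewrite normsq_eq0.
apply: (mulfI n0); rewrite -normsqM !mulfV// /normsq/= expr0n/= addr0.
by rewrite expr1n.
Qed.

(** Expands |f - t z g|^2 >= 0, with z the inner product and t = 1 / (1 + |g|^2). The 1 avoids a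
    separate case for g = 0 and costs only a larger constant. *)
Lemma normsq_cint_le (D : set T) (f g : T -> R[i]) : measurable D ->
  L2on mu D f -> L2on mu D g ->
  normsq (cint mu D (fun x => f x * conjc (g x))) <= (1 + nrm mu D g) * nrm mu D f.
Proof.
move=> mD fi gi; set z := cint _ _ _.
have n0 := nrm_ge0 mu D g.
have t0 : 0 < (1 + nrm mu D g)^-1 by rewrite invr_gt0 ltr_pwDl.
have tn : (1 + nrm mu D g) * (1 + nrm mu D g)^-1 = 1 by rewrite mulfV// gt_eqF// ltr_pwDl.
have := nrm_ge0 mu D (fun x => f x + - ((1 + nrm mu D g)^-1%:C * z) * g x).
rewrite nrmD//; last exact: L2onZ.
rewrite nrmZ// normsqN normsqM normsqC.
have -> : cint mu D (fun x => f x * conjc (- ((1 + nrm mu D g)^-1%:C * z) * g x)) =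
    - ((1 + nrm mu D g)^-1%:C * conjc z) * z.
  rewrite (@eq_cint _ _ _ mu D _ (fun x => - ((1 + nrm mu D g)^-1%:C * conjc z) *
      (f x * conjc (g x)))); last first.
    by move=> x _; rewrite !cJM; apply: complexP; rewrite !ReImE/=; ring.
  by rewrite cintZ//; exact: L2on_mulJ.
move: t0 tn; set t := (1 + _)^-1; move: (nrm mu D g) (nrm mu D f) n0 => n k n0 t0 tn.
have -> : complex.Re (- (t%:C * conjc z) * z) = - t * normsq z.
  by rewrite /normsq !ReImE/=; ring.
have z0 := normsq_ge0 z; move: (normsq z) z0 => q q0 h.
rewrite -(ler_pM2l t0).
have -> : t * ((1 + n) * k) = k by rewrite mulrA (mulrC t) tn mul1r.
have e1 : t ^+ 2 * q * n = t * q - t ^+ 2 * q.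
  have -> : t ^+ 2 * q * n = t * q * ((1 + n) * t) - t ^+ 2 * q by ring.
  by rewrite tn mulr1.
have := mulr_ge0 (sqr_ge0 t) q0; lra.
Qed.

Lemma cmeasV (D : set T) (f : T -> R[i]) : measurable D -> cmeas D f ->
  cmeas D (fun x => (f x)^-1).
Proof.
move=> mD mf; have mn := measurable_normsq mf; case: (mf) => mR mI.
have mV : measurable_fun D (fun x => (normsq (f x))^-1).
  apply: (eq_measurable_fun (fun x => normsq (f x) `^ (-1))).
    by move=> x _; rewrite powR_inv1// normsq_ge0.
  exact: (measurableT_comp (measurable_powR (-1)) mn).
have E z : z^-1 = conjc z * ((normsq z)^-1)%:C :> R[i].
  have [->|z0] := eqVneq z 0; first by rewrite invr0 conjc0 mul0r.
  apply: (mulfI z0); rewrite mulfV// mulrA mulJ_normsq -rmorphM/= mulfV//.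
  by rewrite normsq_eq0.
apply: (@eq_cmeas _ _ _ D (fun x => conjc (f x) * ((normsq (f x))^-1)%:C)).
  by move=> x _; rewrite -E.
apply: cmeasM; first exact: cmeasJ.
by split => //; exact: measurable_cst.
Qed.
End weak_cauchy_schwarz.

(** * The multiplier, the energy identity and the upper Gabor bound *)

Section gabor_bounds.
Context {R : realType}.
Notation mu := (@lebesgue_measure R).
Notation RR := (measurableTypeR R).
Variables (N : nat) (a w : 'I_N -> R[i]) (alpha : R).
Hypothesis w0 : forall k, complex.Re (w k) != 0.
Hypothesis alpha0 : 0 < alpha.
Notation T := (alpha^-1).
Notation p := (window_mult w alpha).
Notation g := (gfun a w).

Let T0 : 0 < T. Proof. by rewrite invr_gt0. Qed.
Let mT : measurable (setT : set RR). Proof. exact: measurableT. Qed.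

Lemma normsq_1B_bounds (r : R) (x : R[i]) : 0 <= r -> normsq x = r ^+ 2 ->
  (1 - r) ^+ 2 <= normsq (1 - x) <= (1 + r) ^+ 2.
Proof.
move=> r0 xr; have : `|complex.Re x| <= r.
  rewrite -ler_sqr ?nnegrE// real_normK ?num_real// -xr /normsq lerDl.
  exact: sqr_ge0.
rewrite ler_norml => /andP[h1 h2].
have -> : normsq (1 - x) = 1 + normsq x - 2 * complex.Re x.
  by rewrite /normsq !ReImE; ring.
by rewrite xr; apply/andP; split; lra.
Qed.

Lemma window_mult_bounds : exists c C : R, [/\ 0 < c, 0 < C &
  forall t, c <= normsq (p t) <= C].
Proof.
pose r k := expR (complex.Re ((2 * pi / alpha)%:C * w k)).
have r1 k : r k != 1.
  rewrite /r -expR0 (inj_eq (@expR_inj R)) cReM/= mul0r subr0 mulf_neq0//.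
  by rewrite gt_eqF// divr_gt0// mulr_gt0// pi_gt0.
exists (\prod_(k < N) (1 - r k) ^+ 2), (\prod_(k < N) (1 + r k) ^+ 2); split.
- by apply: prodr_gt0 => k _; rewrite exprn_even_gt0//= subr_eq0 eq_sym r1.
- by apply: prodr_gt0 => k _; rewrite exprn_gt0// ltr_pwDl// expR_ge0.
move=> t.
have -> : normsq (p t) = \prod_(k < N) normsq (1 - conjc (pole w alpha k) * ee (t * - T)).
  apply: (big_morph (@normsq R)); first exact: normsqM.
  by rewrite /normsq/= expr1n expr0n addr0.
have b k := @normsq_1B_bounds (r k) (conjc (pole w alpha k) * ee (t * - T)) (expR_ge0 _) _.
have e k : normsq (conjc (pole w alpha k) * ee (t * - T)) = r k ^+ 2.
  by rewrite normsqM normsqJ normsq_ee mulr1 normsq_cexp.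
by apply/andP; split; apply: ler_prod => k _; rewrite ?sqr_ge0 ?normsq_ge0/=;
  case/andP: (b e k).
Qed.

Lemma cmeas_window_mult : cmeas (setT : set RR) p.
Proof.
rewrite /window_mult; elim: (index_enum _) => [|k r IH].
  apply: (@eq_cmeas _ _ _ (setT : set RR) (fun=> 1)); last exact: cmeas_cst.
  by move=> t _; rewrite big_nil.
apply: (@eq_cmeas _ _ _ (setT : set RR) (fun t => (1 - conjc (pole w alpha k) * ee (t * - T)) *
  \prod_(k <- r) (1 - conjc (pole w alpha k) * ee (t * - T)))).
  by move=> t _; rewrite big_cons.
apply: cmeasM => //; apply: cmeasB; first exact: cmeas_cst.
by apply: cmeasM; [exact: cmeas_cst|exact: cmeas_ee].
Qed.

Lemma window_mult_neq0 t : p t != 0.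
Proof.
have [c [C [c0 _ /(_ t) /andP[pt _]]]] := window_mult_bounds.
by rewrite -normsq_eq0 gt_eqF// (lt_le_trans c0).
Qed.

Lemma L2on_window_mult (h : R -> R[i]) : L2on mu setT h ->
  L2on mu setT (fun t => p t * h t).
Proof.
move=> hi; have [c [C [_ _ pC]]] := window_mult_bounds.
apply: (@eq_L2on _ _ _ mu setT (fun t => h t * p t) _ mT); first by move=> t _; rewrite mulrC.
apply: L2onM_bounded => //; first exact: cmeas_window_mult.
by exists C => t _; case/andP: (pC t).
Qed.

Lemma L2on_window_div (h : R -> R[i]) : L2on mu setT h ->
  L2on mu setT (fun t => h t * (p t)^-1).
Proof.
move=> hi; have [c [C [c0 _ pC]]] := window_mult_bounds.
apply: L2onM_bounded => //; first by apply: cmeasV => //; exact: cmeas_window_mult.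
exists c^-1 => t _; rewrite normsqV; case/andP: (pC t) => cp _.
by rewrite lef_pV2// posrE// (lt_le_trans c0).
Qed.

(** No estimate of the fractions at infinity is made: p conj g is a finite combination of modulated
    transforms of square-integrable functions, and p is bounded away from zero. *)
Lemma L2on_gfun : L2on mu setT g.
Proof.
have T1 : 0 < T + 1 by rewrite addr_gt0.
have Fi (s : 'I_N) : L2on mu setT (fun t => ee (t * - (s%:R / alpha)) *
    fourier (window_part a w alpha s) t).
  apply: (@eq_L2on _ _ _ mu setT (fun t => fourier (window_part a w alpha s) t *
    ee (t * - (s%:R / alpha))) _ mT); first by move=> t _; rewrite mulrC.
  apply: L2onM_bounded => //; last by exists 1 => t _; rewrite normsq_ee.
    have [vi sv] := L2on_window_part a w alpha0 s 0.
    have E x : window_part a w alpha s x * ee (x * 0) = window_part a w alpha s x.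
      by rewrite mulr0 ee0 mulr1.
    have vi' : L2on mu setT (window_part a w alpha s).
      by apply: (eq_L2on mT _ vi) => x _; rewrite E.
    have sv' : supported (T + 1) (window_part a w alpha s) by move=> x /sv; rewrite E.
    by case: (fourier_L2 T1 vi' sv').
  exact: cmeas_ee.
have pg : L2on mu setT (fun t => p t * conjc (g t)).
  apply: (@eq_L2on _ _ _ mu setT (fun t => (2 * pi)%:C * 'i%C *
    \sum_(s < N) ee (t * - (s%:R / alpha)) * fourier (window_part a w alpha s) t) _ mT).
    by move=> t _; rewrite window_multE.
  by apply: L2onZ => //; exact: L2on_sum.
apply: (eq_L2on mT _ (L2onJ (L2on_window_div pg))) => t _.
by rewrite mulrAC mulfV ?window_mult_neq0// mul1r conjcK.
Qed.

Lemma L2on_gabor_atom k n : L2on mu setT (gabor_atom g alpha k n).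
Proof.
apply: (@eq_L2on _ _ _ mu setT (fun t => g (t + - (alpha * k%:~R)) * ee (t * n%:~R)) _ mT).
  move=> t _; rewrite mulrC /gabor_atom /ee; congr (cexp _ * _).
  by apply: complexP => //=; ring.
apply: L2onM_bounded => //; last by exists 1 => t _; rewrite normsq_ee.
  exact: L2on_shift L2on_gfun.
exact: cmeas_ee.
Qed.

(** Convertible to the middle term of [is_gabor_frame]. *)
Definition gabor_energy (f : R -> R[i]) : \bar R :=
  (\esum_(kn in [set: int * int]) (normsq (inner f (gabor_atom g alpha kn.1 kn.2)))%:E)%E.

Lemma gabor_energy_le2 f f1 f2 : L2on mu setT f1 -> L2on mu setT f2 ->
  (forall x, f x = f1 x + f2 x) ->
  (gabor_energy f <= 2%:E * gabor_energy f1 + 2%:E * gabor_energy f2)%E.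
Proof.
move=> i1 i2 fE.
have n0 (f' : R -> R[i]) (kn : int * int) :
    (0 <= (normsq (inner f' (gabor_atom g alpha kn.1 kn.2)))%:E)%E.
  by rewrite lee_fin normsq_ge0.
have two (x : \bar R) : (2%:E * x = x + x)%E by rewrite -mule2n mule_natl.
rewrite !two /gabor_energy -!esumD//; last 2 first.
- by move=> kn _; rewrite adde_ge0.
- by move=> kn _; rewrite adde_ge0.
apply: le_esum => kn _; rewrite -!EFinD lee_fin.
have -> : inner f (gabor_atom g alpha kn.1 kn.2) =
    inner f1 (gabor_atom g alpha kn.1 kn.2) + inner f2 (gabor_atom g alpha kn.1 kn.2).
  have ai := L2on_gabor_atom kn.1 kn.2.
  rewrite -[LHS]/(cint mu setT (fun x => f x * conjc (gabor_atom g alpha kn.1 kn.2 x))).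
  rewrite (@eq_cint _ _ _ mu setT _ (fun x => f1 x * conjc (gabor_atom g alpha kn.1 kn.2 x) +
    f2 x * conjc (gabor_atom g alpha kn.1 kn.2 x))); last by move=> x _; rewrite fE mulrDl.
  by rewrite cintD//; exact: L2on_mulJ.
by rewrite (le_trans (normsqD_le _ _))// mulrDr; lra.
Qed.

Lemma gabor_energy_mult (L : R) h : 0 < L -> L2on mu setT h -> supported L h ->
  (gabor_energy (fun t => p t * h t)%R =
   (T * (2 * pi) ^+ 2)%:E * fiber_energy a w alpha (fun x => conjc (fourier h x)))%E.
Proof.
move=> L0 hi sh.
have k0 : 0 <= T * (2 * pi) ^+ 2 by rewrite mulr_ge0 ?sqr_ge0// ltW.
have Fc := cmeas_fourier (cintegrable_supported hi sh).
rewrite /fiber_energy integral_esum_int//; last 2 first.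
- by move=> n; apply: measurable_normsqE; apply: cmeas_fib => //; exact: cmeasJ.
- by move=> n x; rewrite lee_fin normsq_ge0.
rewrite -esum_intZl//; last by move=> n; apply: integral_ge0 => x _; rewrite lee_fin normsq_ge0.
(* The frequency n becomes the outer index, because Parseval sums over the time shifts k at fixed
   n. *)
transitivity (\esum_(n in [set: int]) \esum_(k in [set: int])
    (normsq (inner (fun t => p t * h t) (gabor_atom g alpha k n)))%:E)%E.
  rewrite (@esum_esum _ _ _ setT (fun=> setT) (fun n k =>
    (normsq (inner (fun t => p t * h t) (gabor_atom g alpha k n)))%:E)); last first.
    by move=> n k _ _; rewrite lee_fin normsq_ge0.
  rewrite /gabor_energy (@reindex_esum _ _ _ ([set: int] `*`` (fun=> [set: int])) setT
    (fun z : int * int => (z.2, z.1)))//.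
  split => //; first by move=> [x y] [x' y'] _ _ /= [-> ->].
  by move=> [x y] _; exists (y, x).
apply: eq_esum => n _; rewrite (esum_inner_gabor _ w0 alpha0 _ L0)//; congr (_ * _)%E.
apply: eq_integral => x _; congr EFin.
rewrite -normsqJ /fiber cJ_sum; congr normsq; apply: eq_bigr => s _.
by rewrite cJM conjcK mulrC.
Qed.

(** A compactly supported f equals p h with h = f / p, and the energy identity applies. For general
    f only a finite partial sum is estimated: such a sum is continuous in f, so f may be truncated
    at a distance that depends on the finite set. *)
Lemma gabor_energy_bounded : exists2 B : R, 0 < B & forall f, L2on mu setT f ->
  (gabor_energy f <= (B * nrm mu setT f)%:E)%E.
Proof.
have [C C0 HC] := fiber_energy_bounded a w alpha.
have [c [C' [c0 C'0 pc]]] := window_mult_bounds.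
pose k := T * (2 * pi) ^+ 2.
have k0 : 0 < k by rewrite mulr_gt0// exprn_gt0// mulr_gt0// pi_gt0.
(* k is the constant of the energy identity, C the fiber bound, and 1 / c comes from c |h|^2 <= |p
   h|^2 = |f|^2. *)
pose B0 := k * C / c; have B00 : 0 < B0 by rewrite divr_gt0// mulr_gt0.
have supp (L : R) f : 0 < L -> L2on mu setT f -> supported L f ->
    (gabor_energy f <= (B0 * nrm mu setT f)%:E)%E.
  move=> L0 fi sf; pose h t := f t * (p t)^-1.
  have hi : L2on mu setT h by exact: L2on_window_div.
  have sh : supported L h by move=> t /sf; rewrite /h => ->; rewrite mul0r.
  have fE : f = (fun t => p t * h t).
    by apply/funext => t; rewrite /h mulrCA mulfV ?mulr1// window_mult_neq0.
  have [Fi Fn] := fourier_L2 L0 hi sh.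
  rewrite {1}fE (gabor_energy_mult L0 hi sh).
  apply: (@le_trans _ _ (k%:E * (C * nrm mu setT h)%:E)%E).
    apply: lee_wpmul2l; first by rewrite lee_fin ltW.
    by have := HC _ (L2onJ Fi); rewrite nrmJ Fn.
  have hf : c * nrm mu setT h <= nrm mu setT f.
    rewrite fE /nrm -RintegralZl//; last by case: hi.
    apply: le_Rintegral => //.
    - by case: hi => _ ih; have := integrableZl mT c ih; apply: eq_integrable.
    - by case: (L2on_window_mult hi).
    - by move=> t _; rewrite normsqM ler_wpM2r ?normsq_ge0//; case/andP: (pc t).
  rewrite -EFinM lee_fin.
  have -> : B0 * nrm mu setT f = k * C * (nrm mu setT f / c) by rewrite /B0; ring.
  rewrite mulrA; apply: ler_wpM2l; first by rewrite mulr_ge0// ltW.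
  by rewrite ler_pdivlMr// mulrC.
exists (2 * B0); first by rewrite mulr_gt0.
move=> f fi; apply: ge_ereal_sup => _ [A [finA _] <-]; rewrite fsbig_finite//= sumEFin lee_fin.
apply/ler_addgt0Pr => e e0.
pose S := \sum_(kn <- fset_set A) (1 + nrm mu setT (gabor_atom g alpha kn.1 kn.2)).
have S0 : 0 <= S by apply: sumr_ge0 => kn _; rewrite addr_ge0// nrm_ge0.
(* Chosen so that 2 S d <= e for the distance d. The + 1 keeps the denominator positive when the
   finite set is empty. *)
have d0 : 0 < e / (2 * S + 1) by rewrite divr_gt0// ltr_wpDl// mulr_ge0.
have [L L0 fL] := trunc_approx fi d0.
have fLi := L2on_trunc L fi.
have ei := L2onB mT fi fLi.
have h1 : \sum_(kn <- fset_set A) normsq (inner (trunc L f) (gabor_atom g alpha kn.1 kn.2)) <=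
    B0 * nrm mu setT (trunc L f).
  rewrite -lee_fin -sumEFin; apply: le_trans (supp _ _ L0 fLi (@supported_trunc _ L f)).
  apply: esum_ge; exists A => //; by rewrite fsbig_finite.
have h2 : \sum_(kn <- fset_set A) normsq (inner (fun t => f t - trunc L f t)
    (gabor_atom g alpha kn.1 kn.2)) <= S * nrm mu setT (fun t => f t - trunc L f t).
  rewrite mulr_suml ler_sum// => kn _.
  exact: (normsq_cint_le mT ei (L2on_gabor_atom kn.1 kn.2)).
have h3 : nrm mu setT (trunc L f) <= nrm mu setT f.
  by rewrite -subr_ge0 -nrmB_trunc// nrm_ge0.
apply: (@le_trans _ _ (\sum_(kn <- fset_set A)
  2 * (normsq (inner (trunc L f) (gabor_atom g alpha kn.1 kn.2)) +
       normsq (inner (fun t => f t - trunc L f t) (gabor_atom g alpha kn.1 kn.2))))).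
  apply: ler_sum => kn _; apply: le_trans (normsqD_le _ _).
  have ai := L2on_gabor_atom kn.1 kn.2.
  rewrite le_eqVlt; apply/orP; left; apply/eqP; congr normsq.
  rewrite -[LHS]/(cint mu setT (fun x => f x * conjc (gabor_atom g alpha kn.1 kn.2 x))).
  rewrite -[RHS]/(cint mu setT (fun x => trunc L f x * conjc (gabor_atom g alpha kn.1 kn.2 x)) +
    cint mu setT (fun x => (f x - trunc L f x) * conjc (gabor_atom g alpha kn.1 kn.2 x))).
  rewrite -cintD//; [|exact: L2on_mulJ..].
  by apply: eq_cint => x _; ring.
rewrite -mulr_sumr big_split/= mulrDr -mulrA.
apply: lerD; first by rewrite ler_wpM2l// (le_trans h1)// ler_wpM2l// ltW.
have S1 : 0 < 2 * S + 1 by rewrite ltr_wpDl// mulr_ge0.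
rewrite (le_trans (ler_wpM2l _ h2))// mulrA.
rewrite (le_trans (ler_wpM2l _ fL)) ?mulr_ge0//.
rewrite mulrCA ler_piMr ?(ltW e0)// ler_pdivrMr// mul1r lerDl//.
Qed.

End gabor_bounds.

(** * Lower bounds from a dense set to all of L^2 *)

Section dense_lower_bound.
Context {R : realType}.
Notation mu := (@lebesgue_measure R).
Notation RR := (measurableTypeR R).

Let mT : measurable (setT : set RR). Proof. exact: measurableT. Qed.

Lemma L2P (f : R -> R[i]) : L2 f <-> L2on mu setT f.
Proof.
split=> [[mR mI fi]|[[mR mI] fi]].
  split => //; apply/integrableP; split; first exact: measurable_normsqE.
  by under eq_integral do rewrite gee0_abs ?lee_fin ?normsq_ge0//.
split => //; have [_] := integrableP _ _ _ fi.
by under eq_integral do rewrite gee0_abs ?lee_fin ?normsq_ge0//.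
Qed.

Lemma L2norm2E (f : R -> R[i]) : L2on mu setT f -> L2norm2 f = (nrm mu setT f)%:E.
Proof. exact: nrmE. Qed.

(* A lower bound on a dense set passes to all of L^2, with a loss in the
   constant, because Q behaves like the square of a bounded seminorm. *)
Lemma dense_lower_bound (Q : (R -> R[i]) -> \bar R) (C e0 : R) :
  0 <= C -> 0 <= e0 ->
  (forall f, 0 <= Q f)%E ->
  (forall f, L2on mu setT f -> (Q f <= (C * nrm mu setT f)%:E)%E) ->
  (forall f f1 f2, L2on mu setT f1 -> L2on mu setT f2 ->
    (forall x, f x = f1 x + f2 x) -> (Q f <= 2%:E * Q f1 + 2%:E * Q f2)%E) ->
  (forall f (e : R), L2on mu setT f -> 0 < e -> exists h, [/\ L2on mu setT h,
    nrm mu setT (fun x => f x - h x) <= e & ((e0 * nrm mu setT h)%:E <= Q h)%E]) ->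
  forall f, L2on mu setT f -> ((e0 / 4 * nrm mu setT f)%:E <= Q f)%E.
Proof.
move=> C0 e00 Q0 QC Q2 Qd f fi.
have Qfin h : L2on mu setT h -> Q h = (fine (Q h))%:E.
  by move=> hi; rewrite fineK// ge0_fin_numE// (le_lt_trans (QC _ hi))// ltry.
rewrite (Qfin f fi) lee_fin; apply/ler_addgt0Pr => e e_gt0.
have Ce : 0 < C + e0 + 1 by rewrite ltr_wpDl// addr_ge0.
have [d d0 dE] : exists2 d : R, 0 < d & d * (C + e0 + 1) = e.
  by exists (e / (C + e0 + 1)); [rewrite divr_gt0|rewrite divfK// gt_eqF].
have [h [hi fh hQ]] := Qd f d fi d0.
have fhi := L2onB mT fi hi; have hfi := L2onN mT fhi.
have h1 : nrm mu setT f <= 2 * (nrm mu setT h + nrm mu setT (fun x => f x - h x)).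
  have := nrmD_le mT hi fhi.
  by rewrite (@eq_nrm _ _ _ mu setT (fun x => h x + (f x - h x)) f)// => x _; rewrite addrC subrK.
have h2 : (Q h <= 2%:E * Q f + 2%:E * Q (fun x => - (f x - h x))%R)%E.
  by apply: Q2 => // x; rewrite opprB addrC subrK.
have h3 := QC _ hfi; rewrite nrmN in h3.
move: hQ h2 h3; rewrite (Qfin h hi) (Qfin f fi) (Qfin _ hfi) -!EFinM -EFinD !lee_fin.
move: (nrm mu setT f) (nrm mu setT h) (nrm mu setT (fun x => f x - h x)) (nrm_ge0 mu setT h)
  (nrm_ge0 mu setT (fun x => f x - h x)) h1 fh (fine _) (fine _) (fine _)
  => nf nh nd nh0 nd0 h1 fh qh qf qd hQ h2 h3.
have b1 := ler_wpM2l e00 h1; have b2 := ler_wpM2l e00 fh; have b3 := ler_wpM2l C0 fh.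
have b4 : 0 <= d * C by rewrite mulr_ge0// ltW.
have b5 : 0 <= d * e0 by rewrite mulr_ge0// ltW.
have -> : e0 / 4 * nf = e0 * nf / 4 by ring.
by rewrite /=; lra.
Qed.

End dense_lower_bound.

Unset Implicit Arguments.

Theorem theorem2p1 (R : realType) (N : nat) (a w : 'I_N -> R[i]) (alpha : R) :
  (forall k, a k != 0) ->
  (forall k, complex.Re (w k) != 0) ->
  0 < alpha -> alpha <= 1 ->
  is_gabor_frame (gfun a w) alpha <-> cond2 a w alpha.
Proof.
move=> _ w0 alpha0 _.
have mT : measurable (setT : set (measurableTypeR R)) by exact: measurableT.
pose kappa := alpha^-1 * (2 * pi) ^+ 2.
have kappa0 : 0 < kappa by rewrite mulr_gt0 ?invr_gt0// exprn_gt0// mulr_gt0// pi_gt0.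
have [B B0 HB] := gabor_energy_bounded a w0 alpha0.
have [C C0 HC] := fiber_energy_bounded a w alpha.
have [c [c' [c0 c'0 pc]]] := window_mult_bounds w0 alpha0.
have nrm_mult h : L2on lebesgue_measure setT h ->
    c * nrm lebesgue_measure setT h <=
    nrm lebesgue_measure setT (fun t => window_mult w alpha t * h t) <=
    c' * nrm lebesgue_measure setT h.
  move=> hi; have [_ ih] := hi; have [_ ip] := L2on_window_mult w0 alpha0 hi.
  rewrite /nrm -!RintegralZl//; apply/andP; split; apply: le_Rintegral => //.
  - by have := integrableZl mT c ih; apply: eq_integrable.
  - by move=> t _; rewrite normsqM ler_wpM2r ?normsq_ge0//; case/andP: (pc t).
  - by have := integrableZl mT c' ih; apply: eq_integrable.
  - by move=> t _; rewrite normsqM ler_wpM2r ?normsq_ge0//; case/andP: (pc t).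
have energy0 G : (0 <= fiber_energy a w alpha G)%E.
  apply: integral_ge0 => x _; apply: esum_ge0 => n _.
  by rewrite lee_fin normsq_ge0.
have gabor0 f : (0 <= gabor_energy a w alpha f)%E.
  by apply: esum_ge0 => kn _; rewrite lee_fin normsq_ge0.
split.
- move=> [A [B' [A0 _ HA]]].
  (* With G = conj (fourier h), kappa Q(G) is the Gabor energy of p h, hence at least A |p h|^2 >= A
     c |h|^2 = A c |G|^2. The further division by 4 is the loss in [dense_lower_bound]. *)
  pose e0 := A * c / kappa.
  have e00 : 0 < e0 by rewrite divr_gt0// mulr_gt0.
  (* The maximum ensures that the upper constant is not below the lower one. *)
  exists (e0 / 4), (Num.max (e0 / 4) C); split; first by rewrite divr_gt0.
    by rewrite le_max lexx.
  move=> G /L2P Gi; rewrite L2norm2E//; apply/andP; split; last first.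
    apply: (le_trans (HC G Gi)); rewrite -EFinM lee_fin ler_wpM2r ?nrm_ge0//.
    by rewrite le_max lexx orbT.
  rewrite -EFinM; apply: (dense_lower_bound (ltW C0) (ltW e00) energy0 HC _ _ Gi).
    by move=> f f1 f2 [m1 _] [m2 _]; exact: fiber_energy_le2.
  move=> H e Hi e_gt0.
  have [L [h [L0 hi sh hG]]] := fourier_dense Hi e_gt0.
  have [Fhi Fhn] := fourier_L2 L0 hi sh.
  exists (fun x => conjc (fourier h x)); split => //; first exact: L2onJ.
  have phi := L2on_window_mult w0 alpha0 hi.
  have /andP[+ _] := HA _ (proj2 (L2P _) phi).
  rewrite L2norm2E// -[X in (_ <= X)%E]/(gabor_energy a w alpha _).
  rewrite (gabor_energy_mult a w0 alpha0 L0 hi sh) -/kappa nrmJ Fhn => lowA.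
  rewrite -(@lee_pmul2l _ kappa%:E)//; apply: le_trans lowA.
  rewrite -!EFinM lee_fin /e0.
  have -> : kappa * (A * c / kappa * nrm lebesgue_measure setT h) =
      A * (c * nrm lebesgue_measure setT h) by field; rewrite gt_eqF.
  by rewrite ler_wpM2l ?(ltW A0)//; case/andP: (nrm_mult h hi).
- move=> [A [B' [A0 _ HA]]].
  (* Now the upper bound on |p| is needed: the energy of p h is at least kappa A |h|^2, and |h|^2 >=
     |p h|^2 / c'. *)
  pose e0 := kappa * A / c'.
  have e00 : 0 < e0 by rewrite divr_gt0// mulr_gt0.
  exists (e0 / 4), (Num.max (e0 / 4) B); split; first by rewrite divr_gt0.
    by rewrite le_max lexx.
  move=> f /L2P fi; rewrite L2norm2E//; apply/andP; split; last first.
    apply: (le_trans (HB f fi)); rewrite -EFinM lee_fin ler_wpM2r ?nrm_ge0//.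
    by rewrite le_max lexx orbT.
  rewrite -EFinM; apply: (dense_lower_bound (ltW B0) (ltW e00) gabor0 HB _ _ fi).
    by move=> g f1 f2; exact: gabor_energy_le2.
  move=> g e gi e_gt0.
  have [L L0 gL] := trunc_approx gi e_gt0.
  have gLi := L2on_trunc L gi.
  exists (trunc L g); split => //.
  (* Dividing by p preserves the support, so every truncation has the form p h required by the
     energy identity. *)
  pose h t := trunc L g t * (window_mult w alpha t)^-1.
  have hi : L2on lebesgue_measure setT h by exact: L2on_window_div.
  have sh : supported L h.
    by move=> t /(@supported_trunc _ L g); rewrite /h => ->; rewrite mul0r.
  have [Fhi Fhn] := fourier_L2 L0 hi sh.
  have gE : trunc L g = (fun t => window_mult w alpha t * h t).
    by apply/funext => t; rewrite /h mulrCA mulfV ?mulr1// window_mult_neq0.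
  rewrite gE (gabor_energy_mult a w0 alpha0 L0 hi sh) -/kappa.
  have /andP[+ _] := HA _ (proj2 (L2P _) (L2onJ Fhi)).
  rewrite L2norm2E ?nrmJ ?Fhn; last exact: L2onJ.
  rewrite -[X in (_ <= X)%E]/(fiber_energy a w alpha (fun x => conjc (fourier h x))) => H.
  apply: (@le_trans _ _ (kappa%:E * (A%:E * (nrm lebesgue_measure setT h)%:E))%E); last first.
    by apply: lee_wpmul2l => //; rewrite lee_fin ltW.
  rewrite -!EFinM lee_fin /e0.
  have -> : kappa * (A * nrm lebesgue_measure setT h) =
      kappa * A / c' * (c' * nrm lebesgue_measure setT h) by field; rewrite gt_eqF.
  apply: ler_wpM2l; first by rewrite ltW.
  by case/andP: (nrm_mult h hi).
Qed.
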